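(* Let $a,b,c>0$ with $a>b$, and let $M_0$ be the ellipsoid $\frac{x^2}{a}+\frac{y^2}{b}+\frac{z^2}{c}=1$ in $\mathbb{R}^3$. On $M_0$ (away from the tropics), the metric induced from the ambient Minkowski metric $dx^2+dy^2-dz^2$ is geodesically equivalent to the Riemannian metric given by the restriction to $M_0$ of $$ds^2=\frac{\frac{dx^2}{a}+\frac{dy^2}{b}+\frac{dz^2}{c}}{\left|\frac{x^2}{a^2}+\frac{y^2}{b^2}-\frac{z^2}{c^2}\right|}.$$
   Context: The tropics are the two curves on $M_0$ where $\frac{x^2}{a^2}+\frac{y^2}{b^2}-\frac{z^2}{c^2}=0$; they are exactly the points where the induced Minkowski metric degenerates and where $ds^2$ is undefined. Two metrics are called geodesically equivalent if they have the same non-parameterized geodesics. *)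

(* Defs.v *)
From Stdlib Require Import Reals.
From Coquelicot Require Import Coquelicot.
Open Scope R_scope.

Definition R3 : Type := (R * R * R)%type.
Definition cx (p : R3) : R := fst (fst p).
Definition cy (p : R3) : R := snd (fst p).
Definition cz (p : R3) : R := snd p.

Inductive idx : Type := I1 | I2.

Definition sum2 (f : idx -> R) : R := f I1 + f I2.

Definition partial (i : idx) (f : R -> R -> R) (u v : R) : R :=
  match i with
  | I1 => Derive (fun s => f s v) u
  | I2 => Derive (fun s => f u s) v
  end.

Definition vpartial (i : idx) (phi : R -> R -> R3) (u v : R) : R3 :=
  (partial i (fun s t => cx (phi s t)) u v,
   partial i (fun s t => cy (phi s t)) u v,
   partial i (fun s t => cz (phi s t)) u v).

(* Class C^infinity on U; meant for open U, where [ex_diff_n f n] at every point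
   says that f is of class C^n. *)
Definition smooth_on (U : R * R -> Prop) (f : R -> R -> R) : Prop :=
  forall u v, U (u, v) -> forall n, ex_diff_n f n u v.

(* Regular local parametrization of a surface S in R^3: a smooth immersion of
   an open set U of R^2 which is a homeomorphism onto a relatively open subset
   of S. *)
Record local_parametrization
    (S : R3 -> Prop) (U : R * R -> Prop) (phi : R -> R -> R3) : Prop := {
  lp_open : open U;
  lp_smooth_x : smooth_on U (fun u v => cx (phi u v));
  lp_smooth_y : smooth_on U (fun u v => cy (phi u v));
  lp_smooth_z : smooth_on U (fun u v => cz (phi u v));
  lp_immersion : forall u v, U (u, v) -> forall r s : R,
    r * cx (vpartial I1 phi u v) + s * cx (vpartial I2 phi u v) = 0 ->
    r * cy (vpartial I1 phi u v) + s * cy (vpartial I2 phi u v) = 0 ->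
    r * cz (vpartial I1 phi u v) + s * cz (vpartial I2 phi u v) = 0 ->
    r = 0 /\ s = 0;
  lp_injective : forall u v u' v', U (u, v) -> U (u', v') ->
    phi u v = phi u' v' -> u = u' /\ v = v';
  lp_homeo : forall W : R * R -> Prop, open W -> (forall p, W p -> U p) ->
    exists V : R3 -> Prop, open V /\
      forall p, (exists u v, W (u, v) /\ phi u v = p) <-> (V p /\ S p)
}.

(* A field of bilinear forms on the ambient space R^3: [G p v w] is the value
   at the point p on the vectors v and w. *)
Definition tensor : Type := R3 -> R3 -> R3 -> R.

(* Coefficients of the restriction of G to the surface parametrized by phi. *)
Definition gcoef (G : tensor) (phi : R -> R -> R3) (i j : idx) (u v : R) : R :=
  G (phi u v) (vpartial i phi u v) (vpartial j phi u v).

Definition gdet (G : tensor) (phi : R -> R -> R3) (u v : R) : R :=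
  gcoef G phi I1 I1 u v * gcoef G phi I2 I2 u v
  - gcoef G phi I1 I2 u v * gcoef G phi I2 I1 u v.

Definition ginv (G : tensor) (phi : R -> R -> R3) (k l : idx) (u v : R) : R :=
  match k, l with
  | I1, I1 => gcoef G phi I2 I2 u v / gdet G phi u v
  | I1, I2 => - gcoef G phi I1 I2 u v / gdet G phi u v
  | I2, I1 => - gcoef G phi I2 I1 u v / gdet G phi u v
  | I2, I2 => gcoef G phi I1 I1 u v / gdet G phi u v
  end.

(* Gamma^k_{ij} of the Levi-Civita connection. *)
Definition christoffel (G : tensor) (phi : R -> R -> R3)
    (k i j : idx) (u v : R) : R :=
  / 2 * sum2 (fun l => ginv G phi k l u v *
    (partial i (gcoef G phi j l) u v + partial j (gcoef G phi i l) u v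
     - partial l (gcoef G phi i j) u v)).

(* G restricts to a smooth pseudo-Riemannian metric (of any signature, possibly
   different on different components) on the surface S. *)
Definition pseudo_riemannian_on (S : R3 -> Prop) (G : tensor) : Prop :=
  forall U phi, local_parametrization S U phi ->
    (forall i j, smooth_on U (gcoef G phi i j)) /\
    forall u v, U (u, v) ->
      gcoef G phi I1 I2 u v = gcoef G phi I2 I1 u v /\ gdet G phi u v <> 0.

Definition riemannian_on (S : R3 -> Prop) (G : tensor) : Prop :=
  pseudo_riemannian_on S G /\
  forall U phi, local_parametrization S U phi ->
    forall u v, U (u, v) -> forall xi : idx -> R, (exists i, xi i <> 0) ->
      0 < sum2 (fun i => sum2 (fun j => gcoef G phi i j u v * xi i * xi j)).

Definition open_interval (J : R -> Prop) : Prop :=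
  open J /\ forall x y z, J x -> J y -> x <= z <= y -> J z.

Definition geodesic_equation (G : tensor) (phi : R -> R -> R3)
    (q : idx -> R -> R) (t : R) : Prop :=
  forall k, Derive_n (q k) 2 t
    + sum2 (fun i => sum2 (fun j =>
        christoffel G phi k i j (q I1 t) (q I2 t)
        * Derive (q i) t * Derive (q j) t)) = 0.

(* Affinely parametrized geodesic gamma : J -> S.  The geodesic equation does
   not depend on the local parametrization, so it is required in one around
   each point; this way it is not vacuous. *)
Definition geodesic (S : R3 -> Prop) (G : tensor)
    (J : R -> Prop) (gamma : R -> R3) : Prop :=
  forall t0, J t0 ->
    exists (U : R * R -> Prop) (phi : R -> R -> R3) (q : idx -> R -> R),
      local_parametrization S U phi /\
      locally t0 (fun t =>
        U (q I1 t, q I2 t) /\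
        gamma t = phi (q I1 t) (q I2 t) /\
        (forall k, ex_derive (q k) t /\ ex_derive (Derive (q k)) t) /\
        geodesic_equation G phi q t).

(* C^2 diffeomorphism tau from J onto I; for intervals, injectivity follows
   from the derivative having no zero. *)
Definition reparametrization (J I : R -> Prop) (tau : R -> R) : Prop :=
  (forall t, J t ->
     I (tau t) /\ ex_derive tau t /\ ex_derive (Derive tau) t /\
     continuous (Derive_n tau 2) t /\ Derive tau t <> 0) /\
  (forall s, I s -> exists t, J t /\ tau t = s).

Definition unparametrized_geodesic (S : R3 -> Prop) (G : tensor)
    (I : R -> Prop) (gamma : R -> R3) : Prop :=
  exists (J : R -> Prop) (tau : R -> R),
    open_interval J /\ reparametrization J I tau /\
    geodesic S G J (fun t => gamma (tau t)).

Definition geodesically_equivalent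
    (S : R3 -> Prop) (G1 G2 : tensor) : Prop :=
  forall (I : R -> Prop) (gamma : R -> R3), open_interval I ->
    (unparametrized_geodesic S G1 I gamma <->
     unparametrized_geodesic S G2 I gamma).

Definition ellipsoid (a b c : R) (p : R3) : Prop :=
  cx p ^ 2 / a + cy p ^ 2 / b + cz p ^ 2 / c = 1.

(* The tropics are the zero set of this function on the ellipsoid. *)
Definition tropic_fun (a b c : R) (p : R3) : R :=
  cx p ^ 2 / a ^ 2 + cy p ^ 2 / b ^ 2 - cz p ^ 2 / c ^ 2.

Definition ellipsoid_off_tropics (a b c : R) (p : R3) : Prop :=
  ellipsoid a b c p /\ tropic_fun a b c p <> 0.

Definition minkowski : tensor := fun _ v w =>
  cx v * cx w + cy v * cy w - cz v * cz w.

(* The bilinear form polarizing the quadratic form ds^2. *)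
Definition ds2 (a b c : R) : tensor := fun p v w =>
  (cx v * cx w / a + cy v * cy w / b + cz v * cz w / c)
  / Rabs (tropic_fun a b c p).

(* Main.v *)
From Stdlib Require Import Reals Lra Psatz Nsatz Classical ClassicalEpsilon.
From Stdlib Require Ranalysis5.
From Coquelicot Require Import Coquelicot.
Require Import Defs.
Open Scope R_scope.

(** Let [F] be the tropic function, [N = (x/a, y/b, -z/c)] the Minkowski normal
    of the ellipsoid and [Q = x'^2/a + y'^2/b + z'^2/c].  Differentiating the
    equation of the ellipsoid twice along a curve [gamma] gives
    [n . gamma'' = - Q] for the Euclidean normal [n = (x/a, y/b, z/c)], and
    [n . N = F].  Hence the geodesics of the Minkowski metric are the curves with
    [gamma'' = - (Q/F) N], and the Euler-Lagrange equation of [Q/|F|] under the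
    constraint, whose multiplier turns out to vanish, reads
    [gamma'' = (F'/F) gamma' - (Q/F) N].  The two equations differ by a multiple
    of [gamma'], which a change of parameter [sigma] with
    [sigma'' = +/- (F'/F) sigma'^2] absorbs. *)

(** * Smooth functions of two variables *)

(** Why the two equations match: with D = diag(1/a, 1/b, 1/c) one has n = D gamma and grad F = 2 D
    N. So the force that the factor 1/|F| adds to the Euler-Lagrange equation points along N once D
    is cancelled, with the same coefficient - Q/F as in the Minkowski case. If w is the defect of
    the second equation, the multiplier in D w = lambda n is found by pairing with gamma: gamma . n
    = 1, while gamma . D w = n . w = 0 by the twice differentiated constraint. Geodesics are defined
    by Christoffel symbols in charts that vary with the instant, and a chart gives two equations for
    the three coordinates of gamma''. The constraint supplies the normal component, so each geodesic
    equation is equivalent to an ambient vector equation, and the two differ only in a number m, 0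
    or 1. The equation for sigma integrates to sigma' = |F|^(m' - m), with F taken along the
    reparametrized curve. Since F is a function on the surface, this is solved on the whole interval
    at once, without gluing charts. *)

Definition is_partial (i : idx) (f : R -> R -> R) (u v l : R) : Prop :=
  match i with
  | I1 => is_derive (fun s => f s v) u l
  | I2 => is_derive (fun s => f u s) v l
  end.

Lemma is_partial_unique i f u v l : is_partial i f u v l -> partial i f u v = l.
Proof. destruct i; apply is_derive_unique. Qed.

Lemma open_locally_2d (U : R * R -> Prop) u v :
  open U -> U (u, v) -> locally_2d (fun s t => U (s, t)) u v.
Proof.
  intros oU Huv. apply locally_2d_locally.
  generalize (oU _ Huv). apply filter_imp. now intros [s t].
Qed.

Lemma is_partial_ext_loc i f g u v l :
  locally_2d (fun s t => f s t = g s t) u v ->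
  is_partial i f u v l -> is_partial i g u v l.
Proof.
  intros H. destruct i; simpl; apply is_derive_ext_loc.
  - exact (locally_2d_1d_const_y _ _ _ H).
  - exact (locally_2d_1d_const_x _ _ _ H).
Qed.

Lemma is_partial_const i c u v : is_partial i (fun _ _ => c) u v 0.
Proof. destruct i; apply (is_derive_const c). Qed.

Lemma is_partial_plus i f g u v l m :
  is_partial i f u v l -> is_partial i g u v m ->
  is_partial i (fun s t => f s t + g s t) u v (l + m).
Proof. destruct i; apply (is_derive_plus (V := R_NormedModule)). Qed.

Lemma is_partial_mult i f g u v l m :
  is_partial i f u v l -> is_partial i g u v m ->
  is_partial i (fun s t => f s t * g s t) u v (l * g u v + f u v * m).
Proof.
  destruct i; intros Hf Hg;
    apply (is_derive_mult _ _ _ _ _ Hf Hg); intros; apply Rmult_comm.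
Qed.

Lemma is_partial_inv i f u v l :
  is_partial i f u v l -> f u v <> 0 ->
  is_partial i (fun s t => / f s t) u v (- l / f u v ^ 2).
Proof. destruct i; intros Hf H0; exact (is_derive_inv _ _ _ Hf H0). Qed.

Lemma is_partial_Rabs i f u v l :
  is_partial i f u v l -> f u v <> 0 ->
  is_partial i (fun s t => Rabs (f s t)) u v (sign (f u v) * l).
Proof. destruct i; intros Hf H0; exact (is_derive_Rabs _ _ _ Hf H0). Qed.

Lemma ex_diff_n_S f n u v :
  ex_diff_n f (S n) u v <->
  continuity_2d_pt f u v /\
  forall i, is_partial i f u v (partial i f u v) /\
    ex_diff_n (partial i f) n u v.
Proof.
  split.
  - intros (Hc & H1 & H2 & H3 & H4). split; [exact Hc|].
    intros [|]; split; try assumption; now apply Derive_correct.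
  - intros (Hc & H). destruct (H I1) as [H1 H3], (H I2) as [H2 H4].
    repeat split; try assumption; eexists; eassumption.
Qed.

(** Closure under products and inverses goes by induction on the order of differentiability, which
    [smooth_on] quantifies away. *)
Definition Cn_on (n : nat) (U : R * R -> Prop) (f : R -> R -> R) : Prop :=
  forall u v, U (u, v) -> ex_diff_n f n u v.

Section Smooth.

Variable U : R * R -> Prop.
Hypothesis oU : open U.

Lemma Cn_on_ext n f g :
  (forall u v, U (u, v) -> f u v = g u v) -> Cn_on n U f -> Cn_on n U g.
Proof.
  intros E Hf u v Huv. apply (ex_diff_n_ext_loc f); [|now apply Hf].
  generalize (open_locally_2d _ _ _ oU Huv). apply locally_2d_impl.
  apply locally_2d_forall. intros s t. apply E.
Qed.

Lemma Cn_on_pred n f : Cn_on (S n) U f -> Cn_on n U f.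
Proof. intros Hf u v Huv. apply (ex_diff_n_m (S n)); auto. Qed.

Lemma Cn_on_continuity n f u v :
  Cn_on n U f -> U (u, v) -> continuity_2d_pt f u v.
Proof. intros Hf Huv. specialize (Hf u v Huv). destruct n; apply Hf. Qed.

Lemma Cn_on_S_intro n f (df : idx -> R -> R -> R) :
  (forall u v, U (u, v) -> continuity_2d_pt f u v) ->
  (forall i u v, U (u, v) -> is_partial i f u v (df i u v)) ->
  (forall i, Cn_on n U (df i)) -> Cn_on (S n) U f.
Proof.
  intros Hc Hd Hn u v Huv. apply ex_diff_n_S. split; [now apply Hc|].
  intros i. split.
  - rewrite (is_partial_unique _ _ _ _ _ (Hd i u v Huv)). now apply Hd.
  - revert u v Huv. apply (Cn_on_ext n (df i)); [|apply Hn].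
    intros u v Huv. symmetry. now apply is_partial_unique, Hd.
Qed.

Lemma Cn_on_is_partial n f i u v :
  Cn_on (S n) U f -> U (u, v) -> is_partial i f u v (partial i f u v).
Proof.
  intros Hf Huv. now destruct (proj1 (ex_diff_n_S _ _ _ _) (Hf u v Huv)) as [_ H];
    apply H.
Qed.

Lemma Cn_on_partial n f i : Cn_on (S n) U f -> Cn_on n U (partial i f).
Proof.
  intros Hf u v Huv. now destruct (proj1 (ex_diff_n_S _ _ _ _) (Hf u v Huv)) as [_ H];
    apply H.
Qed.

Lemma Cn_on_const n c : Cn_on n U (fun _ _ => c).
Proof.
  revert c; induction n as [|n IH]; intros c.
  - intros u v _. split; [apply continuity_2d_pt_const|exact I].
  - apply (Cn_on_S_intro n _ (fun _ _ _ => 0)).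
    + intros; apply continuity_2d_pt_const.
    + intros; apply is_partial_const.
    + intros _. apply IH.
Qed.

Lemma Cn_on_plus n f g :
  Cn_on n U f -> Cn_on n U g -> Cn_on n U (fun u v => f u v + g u v).
Proof.
  revert f g; induction n as [|n IH]; intros f g Hf Hg.
  - intros u v Huv. split; [|exact I].
    apply continuity_2d_pt_plus; now apply (Cn_on_continuity 0).
  - apply (Cn_on_S_intro n _ (fun i u v => partial i f u v + partial i g u v)).
    + intros. apply continuity_2d_pt_plus; now apply (Cn_on_continuity (S n)).
    + intros. apply is_partial_plus; now apply (Cn_on_is_partial n).
    + intros i. apply IH; now apply Cn_on_partial.
Qed.

Lemma Cn_on_mult n f g :
  Cn_on n U f -> Cn_on n U g -> Cn_on n U (fun u v => f u v * g u v).
Proof.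
  revert f g; induction n as [|n IH]; intros f g Hf Hg.
  - intros u v Huv. split; [|exact I].
    apply continuity_2d_pt_mult; now apply (Cn_on_continuity 0).
  - apply (Cn_on_S_intro n _
      (fun i u v => partial i f u v * g u v + f u v * partial i g u v)).
    + intros. apply continuity_2d_pt_mult; now apply (Cn_on_continuity (S n)).
    + intros. apply is_partial_mult; now apply (Cn_on_is_partial n).
    + intros i. apply Cn_on_plus; apply IH;
        first [now apply Cn_on_partial | now apply Cn_on_pred].
Qed.

Lemma Cn_on_inv n f :
  (forall u v, U (u, v) -> f u v <> 0) ->
  Cn_on n U f -> Cn_on n U (fun u v => / f u v).
Proof.
  intros H0; induction n as [|n IH]; intros Hf.
  - intros u v Huv. split; [|exact I].
    apply continuity_2d_pt_inv; [now apply (Cn_on_continuity 0)|auto].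
  (* The derivative is written with the factor [/ f u v] twice, so that the induction hypothesis on
     the inverse itself applies to it. *)
  - apply (Cn_on_S_intro n _
      (fun i u v => (-1 * partial i f u v) * (/ f u v * / f u v))).
    + intros. apply continuity_2d_pt_inv; [now apply (Cn_on_continuity (S n))|auto].
    + intros i u v Huv.
      replace (-1 * partial i f u v * (/ f u v * / f u v))
        with (- partial i f u v / f u v ^ 2) by (field; auto).
      apply is_partial_inv; [now apply (Cn_on_is_partial n)|auto].
    + intros i. assert (Hi := IH (Cn_on_pred _ _ Hf)).
      apply Cn_on_mult; apply Cn_on_mult; auto using Cn_on_const, Cn_on_partial.
Qed.

Lemma smooth_on_Cn f : smooth_on U f <-> forall n, Cn_on n U f.
Proof. split; intros H; repeat intro; now apply H. Qed.

Lemma smooth_on_is_partial f i u v :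
  smooth_on U f -> U (u, v) -> is_partial i f u v (partial i f u v).
Proof. intros Hf. apply (Cn_on_is_partial 0). now apply smooth_on_Cn. Qed.

Lemma smooth_on_continuity f u v :
  smooth_on U f -> U (u, v) -> continuity_2d_pt f u v.
Proof. intros Hf. apply (Cn_on_continuity 0). now apply smooth_on_Cn. Qed.

Lemma smooth_on_partial f i : smooth_on U f -> smooth_on U (partial i f).
Proof.
  rewrite !smooth_on_Cn. intros Hf n. now apply Cn_on_partial.
Qed.

Lemma smooth_on_const c : smooth_on U (fun _ _ => c).
Proof. apply smooth_on_Cn. intros n. apply Cn_on_const. Qed.

Lemma smooth_on_plus f g :
  smooth_on U f -> smooth_on U g -> smooth_on U (fun u v => f u v + g u v).
Proof. rewrite !smooth_on_Cn. intros Hf Hg n. now apply Cn_on_plus. Qed.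

Lemma smooth_on_mult f g :
  smooth_on U f -> smooth_on U g -> smooth_on U (fun u v => f u v * g u v).
Proof. rewrite !smooth_on_Cn. intros Hf Hg n. now apply Cn_on_mult. Qed.

Lemma smooth_on_inv f :
  (forall u v, U (u, v) -> f u v <> 0) ->
  smooth_on U f -> smooth_on U (fun u v => / f u v).
Proof. rewrite !smooth_on_Cn. intros H0 Hf n. now apply Cn_on_inv. Qed.

Lemma smooth_on_ext f g :
  (forall u v, U (u, v) -> f u v = g u v) -> smooth_on U f -> smooth_on U g.
Proof. rewrite !smooth_on_Cn. intros E Hf n. now apply (Cn_on_ext n f). Qed.

(** Near a point where [f] does not vanish its sign is constant, so [Rabs f] is there a constant
    multiple of [f]. The radius comes from continuity with tolerance [Rabs (f u v)]. *)
Lemma smooth_on_Rabs f :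
  (forall u v, U (u, v) -> f u v <> 0) ->
  smooth_on U f -> smooth_on U (fun u v => Rabs (f u v)).
Proof.
  intros H0 Hf u v Huv n.
  assert (Hc := smooth_on_continuity f u v Hf Huv).
  assert (Hs := H0 u v Huv).
  apply (ex_diff_n_ext_loc (fun s t => sign (f u v) * f s t)).
  - destruct (Hc (mkposreal _ (Rabs_pos_lt _ Hs))) as [d Hd].
    exists d. intros s t Hs' Ht'. specialize (Hd s t Hs' Ht'). simpl in Hd.
    revert Hd. destruct (Rle_or_lt (f u v) 0) as [Hle|Hlt].
    + assert (f u v < 0) by lra. rewrite sign_eq_m1 by lra.
      rewrite (Rabs_left (f u v)) by lra. intros Hd.
      apply Rabs_def2 in Hd. rewrite Rabs_left; lra.
    + rewrite sign_eq_1 by lra. rewrite (Rabs_right (f u v)) by lra. intros Hd.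
      apply Rabs_def2 in Hd. rewrite Rabs_right; lra.
  - now apply (smooth_on_mult (fun _ _ => sign (f u v)) f (smooth_on_const _) Hf).
Qed.

Lemma smooth_on_partial_comm f u v :
  smooth_on U f -> U (u, v) ->
  partial I1 (partial I2 f) u v = partial I2 (partial I1 f) u v.
Proof.
  intros Hf Huv.
  assert (Hp := fun i => smooth_on_partial f i Hf).
  assert (Hpp := fun i j => smooth_on_partial _ j (Hp i)).
  apply Schwarz.
  - generalize (open_locally_2d _ _ _ oU Huv). apply locally_2d_impl.
    apply locally_2d_forall. intros s t Hst. repeat split.
    + eexists. exact (smooth_on_is_partial f I1 s t Hf Hst).
    + eexists. exact (smooth_on_is_partial f I2 s t Hf Hst).
    + eexists. exact (smooth_on_is_partial _ I1 s t (Hp I2) Hst).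
    + eexists. exact (smooth_on_is_partial _ I2 s t (Hp I1) Hst).
  - exact (smooth_on_continuity _ u v (Hpp I2 I1) Huv).
  - exact (smooth_on_continuity _ u v (Hpp I1 I2) Huv).
Qed.

(** The chain rule needs total differentiability; it follows from one partial derivative existing
    nearby and being continuous at the point, and the other existing at the point. *)
Lemma smooth_on_chain_rule f (q : idx -> R -> R) (dq : idx -> R) t :
  smooth_on U f -> U (q I1 t, q I2 t) ->
  (forall k, is_derive (q k) t (dq k)) ->
  is_derive (fun s => f (q I1 s) (q I2 s)) t
    (partial I1 f (q I1 t) (q I2 t) * dq I1
     + partial I2 f (q I1 t) (q I2 t) * dq I2).
Proof.
  intros Hf HU Hq.
  apply is_derive_Reals.
  apply derivable_pt_lim_comp_2d; try (apply is_derive_Reals; apply Hq).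
  apply filterdiff_differentiable_pt_lim.
  apply (is_derive_filterdiff f _ _ (partial I1 f)).
  - generalize (oU _ HU). apply filter_imp. intros [s s'] H.
    exact (smooth_on_is_partial f I1 s s' Hf H).
  - exact (smooth_on_is_partial f I2 _ _ Hf HU).
  - apply continuity_2d_pt_filterlim.
    exact (smooth_on_continuity _ _ _ (smooth_on_partial f I1 Hf) HU).
Qed.

Lemma smooth_on_lincomb f g h (al be ga : R) :
  smooth_on U f -> smooth_on U g -> smooth_on U h ->
  smooth_on U (fun u v => al * f u v + be * g u v + ga * h u v).
Proof.
  intros Hf Hg Hh.
  apply (smooth_on_plus (fun u v => al * f u v + be * g u v) (fun u v => ga * h u v)).
  - apply (smooth_on_plus (fun u v => al * f u v) (fun u v => be * g u v));
      apply (smooth_on_mult (fun _ _ => _)); auto; now apply smooth_on_const.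
  - apply (smooth_on_mult (fun _ _ => _)); auto; now apply smooth_on_const.
Qed.

(** With suitable weights this diagonal form covers the equation of the ellipsoid, its first
    derivatives, the tropic function, the Minkowski coefficients and the numerator of [ds2]. *)
Lemma is_partial_bilinear i (al be ga : R) (f1 f2 g1 g2 h1 h2 : R -> R -> R) u v :
  U (u, v) -> smooth_on U f1 -> smooth_on U f2 -> smooth_on U g1 ->
  smooth_on U g2 -> smooth_on U h1 -> smooth_on U h2 ->
  is_partial i (fun s t => al * (f1 s t * f2 s t) + be * (g1 s t * g2 s t)
                           + ga * (h1 s t * h2 s t)) u v
    (al * (partial i f1 u v * f2 u v + f1 u v * partial i f2 u v)
     + be * (partial i g1 u v * g2 u v + g1 u v * partial i g2 u v)
     + ga * (partial i h1 u v * h2 u v + h1 u v * partial i h2 u v)).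
Proof.
  intros HU F1 F2 G1 G2 H1 H2.
  assert (M : forall k p q, smooth_on U p -> smooth_on U q ->
    is_partial i (fun s t => k * (p s t * q s t)) u v
      (k * (partial i p u v * q u v + p u v * partial i q u v))).
  { intros k p q Hp Hq.
    replace (k * (partial i p u v * q u v + p u v * partial i q u v)) with
      (0 * (p u v * q u v) + k * (partial i p u v * q u v + p u v * partial i q u v))
      by ring.
    apply (is_partial_mult i (fun _ _ => k) (fun s t => p s t * q s t));
      [apply is_partial_const|].
    apply is_partial_mult; now apply smooth_on_is_partial. }
  apply (is_partial_plus i (fun s t => al * (f1 s t * f2 s t) + be * (g1 s t * g2 s t))
    (fun s t => ga * (h1 s t * h2 s t))); [|now apply M].
  apply (is_partial_plus i (fun s t => al * (f1 s t * f2 s t))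
    (fun s t => be * (g1 s t * g2 s t))); now apply M.
Qed.

Lemma smooth_on_bilinear (al be ga : R) (f1 f2 g1 g2 h1 h2 : R -> R -> R) :
  smooth_on U f1 -> smooth_on U f2 -> smooth_on U g1 ->
  smooth_on U g2 -> smooth_on U h1 -> smooth_on U h2 ->
  smooth_on U (fun s t => al * (f1 s t * f2 s t) + be * (g1 s t * g2 s t)
                           + ga * (h1 s t * h2 s t)).
Proof.
  intros F1 F2 G1 G2 H1 H2.
  apply (smooth_on_lincomb (fun s t => f1 s t * f2 s t) (fun s t => g1 s t * g2 s t)
    (fun s t => h1 s t * h2 s t)); now apply smooth_on_mult.
Qed.

Lemma is_partial_locally_const i f k u v :
  U (u, v) -> (forall s t, U (s, t) -> f s t = k) -> forall l,
  is_partial i f u v l -> l = 0.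
Proof.
  intros HU Hf l Hl. rewrite <- (is_partial_unique _ _ _ _ _ Hl).
  apply is_partial_unique. apply (is_partial_ext_loc i (fun _ _ => k)).
  - generalize (open_locally_2d _ _ _ oU HU). apply locally_2d_impl.
    apply locally_2d_forall. intros s t H. symmetry. now apply Hf.
  - apply is_partial_const.
Qed.

End Smooth.

(** * Changes of parameter *)

Lemma is_derive_R_comp (f g : R -> R) x df dg :
  is_derive f (g x) df -> is_derive g x dg ->
  is_derive (fun y => f (g y)) x (dg * df).
Proof. exact (is_derive_comp f g x df dg). Qed.

Lemma ex_derive_R_continuous (f : R -> R) x : ex_derive f x -> continuous f x.
Proof. exact (ex_derive_continuous f x). Qed.

Lemma open_interval_primitive (J : R -> Prop) (f : R -> R) (t0 : R) :
  open_interval J -> J t0 -> (forall t, J t -> continuous f t) ->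
  forall t, J t -> is_derive (RInt f t0) t (f t).
Proof.
  intros [oJ cJ] H0 Hc t Ht.
  apply (is_derive_RInt f _ t0); [|now apply Hc].
  generalize (oJ t Ht). apply filter_imp. intros s Hs.
  apply (RInt_correct f), (ex_RInt_continuous f). intros z Hz. apply Hc.
  destruct (Rle_dec t0 s) as [H|H].
  - rewrite Rmin_left, Rmax_right in Hz by lra. apply (cJ t0 s); auto.
  - rewrite Rmin_right, Rmax_left in Hz by lra. apply (cJ s t0); auto.
Qed.

(** * Inverse of a function with positive derivative on an open interval *)

Section Inverse.

Variables (J : R -> Prop) (S f : R -> R).
Hypothesis HJ : open_interval J.
Hypothesis HS : forall t, J t -> is_derive S t (f t).
Hypothesis Hpos : forall t, J t -> 0 < f t.

Let image (s : R) : Prop := exists t, J t /\ S t = s.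

Lemma increasing_on_interval t1 t2 : J t1 -> J t2 -> t1 < t2 -> S t1 < S t2.
Proof.
  intros H1 H2 Hlt.
  assert (HI : forall x, Rmin t1 t2 <= x <= Rmax t1 t2 -> J x).
  { intros x. rewrite Rmin_left, Rmax_right by lra. now apply HJ. }
  destruct (MVT_gen S t1 t2 f) as (c & Hc & E).
  - intros x Hx. apply HS, HI. lra.
  - intros x Hx. apply continuity_pt_filterlim, ex_derive_R_continuous.
    eexists. apply HS, HI. exact Hx.
  - assert (0 < f c * (t2 - t1)); [|lra].
    apply Rmult_lt_0_compat; [now apply Hpos, HI|lra].
Qed.

Lemma intermediate_value_on_interval t1 t2 s :
  J t1 -> J t2 -> t1 < t2 -> S t1 <= s <= S t2 ->
  exists t, t1 <= t <= t2 /\ J t /\ S t = s.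
Proof.
  intros H1 H2 Hlt Hs.
  destruct (Ranalysis5.f_interv_is_interv S t1 t2 s Hlt Hs) as (t & Ht & E).
  - intros x Hx. apply continuity_pt_filterlim, ex_derive_R_continuous.
    eexists. apply HS. now apply (proj2 HJ t1 t2).
  - exists t. repeat split; try lra. now apply (proj2 HJ t1 t2).
Qed.

Lemma injective_on_interval t1 t2 : J t1 -> J t2 -> S t1 = S t2 -> t1 = t2.
Proof.
  intros H1 H2 E. destruct (Rtotal_order t1 t2) as [H|[H|H]]; [|exact H|].
  - assert (Hi := increasing_on_interval _ _ H1 H2 H). lra.
  - assert (Hi := increasing_on_interval _ _ H2 H1 H). lra.
Qed.

Lemma strict_monotone_inverse t1 t2 : J t1 -> J t2 -> S t1 < S t2 -> t1 < t2.
Proof.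
  intros H1 H2 E. destruct (Rtotal_order t1 t2) as [H|[H|H]]; [exact H| |].
  - subst. lra.
  - assert (Hi := increasing_on_interval _ _ H2 H1 H). lra.
Qed.

Let sigma (s : R) : R := epsilon (inhabits 0) (fun t => J t /\ S t = s).

Lemma inverse_spec s : image s -> J (sigma s) /\ S (sigma s) = s.
Proof. exact (epsilon_spec (inhabits 0) (fun t => J t /\ S t = s)). Qed.

(** By the intermediate value theorem the image of a small segment around [sigma s] contains a
    neighbourhood of [s]. This yields both the openness of the image and the continuity of the
    inverse. *)
Lemma inverse_near s (eps : posreal) :
  image s -> locally s (fun s' => image s' /\ Rabs (sigma s' - sigma s) < eps).
Proof.
  intros Hs. destruct (inverse_spec s Hs) as [HJs E].
  destruct (proj1 HJ _ HJs) as [d Hd].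
  (* Halving makes [e] strictly smaller than both radii: the endpoints stay in [J], and the whole
     segment lies within [eps]. *)
  set (e := Rmin d eps / 2).
  assert (He : 0 < e /\ e < d /\ e < eps).
  { assert (H1 := Rmin_l d eps). assert (H2 := Rmin_r d eps).
    assert (0 < Rmin d eps) by (apply Rmin_pos; apply cond_pos). unfold e. lra. }
  assert (Jm : J (sigma s - e)).
  { apply Hd. change (Rabs (sigma s - e - sigma s) < d).
    rewrite Rabs_left by lra. lra. }
  assert (Jp : J (sigma s + e)).
  { apply Hd. change (Rabs (sigma s + e - sigma s) < d).
    rewrite Rabs_right by lra. lra. }
  assert (Lm := increasing_on_interval _ _ Jm HJs ltac:(lra)).
  assert (Lp := increasing_on_interval _ _ HJs Jp ltac:(lra)).
  rewrite E in Lm, Lp.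
  assert (Hd' : 0 < Rmin (s - S (sigma s - e)) (S (sigma s + e) - s))
    by (apply Rmin_pos; lra).
  exists (mkposreal _ Hd'). intros s' Hs'.
  change (Rabs (s' - s) < Rmin (s - S (sigma s - e)) (S (sigma s + e) - s)) in Hs'.
  assert (H1 := Rmin_l (s - S (sigma s - e)) (S (sigma s + e) - s)).
  assert (H2 := Rmin_r (s - S (sigma s - e)) (S (sigma s + e) - s)).
  apply Rabs_def2 in Hs'.
  destruct (intermediate_value_on_interval _ _ s' Jm Jp ltac:(lra) ltac:(lra))
    as (t & Ht & Jt & Et).
  assert (Hi : image s') by now exists t.
  split; [exact Hi|].
  destruct (inverse_spec s' Hi) as [Js' Es'].
  replace (sigma s') with t by (apply injective_on_interval; congruence).
  apply Rabs_def1; lra.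
Qed.

Lemma image_open_interval : open_interval image.
Proof.
  split.
  - intros s Hs. generalize (inverse_near s (mkposreal 1 Rlt_0_1) Hs).
    apply filter_imp. tauto.
  - intros x y z (t1 & J1 & E1) (t2 & J2 & E2) Hz.
    destruct (Rtotal_order t1 t2) as [H|[H|H]].
    + destruct (intermediate_value_on_interval t1 t2 z) as (t & _ & Ht); try lra; auto.
      now exists t.
    + exists t1. split; [exact J1|]. subst t2. lra.
    + assert (Hi := increasing_on_interval _ _ J2 J1 H).
      exists t1. split; [exact J1|]. lra.
Qed.

Lemma inverse_continuous s : image s -> continuous sigma s.
Proof.
  intros Hs. apply filterlim_locally. intros eps.
  generalize (inverse_near s eps Hs). apply filter_imp. now intros s' [_ H].
Qed.

Lemma inverse_is_derive s : image s -> is_derive sigma s (/ f (sigma s)).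
Proof.
  intros Hs. destruct (inverse_spec s Hs) as [HJs E].
  destruct (proj1 image_open_interval s Hs) as [d Hd].
  assert (dp := cond_pos d).
  assert (Him : forall x, s - d / 2 <= x <= s + d / 2 -> image x).
  { intros x Hx. apply Hd. change (Rabs (x - s) < d). apply Rabs_def1; lra. }
  assert (Hinc : forall x y, image x -> image y -> x < y -> sigma x < sigma y).
  { intros x y Hx Hy Hxy.
    destruct (inverse_spec x Hx), (inverse_spec y Hy).
    apply strict_monotone_inverse; auto. congruence. }
  assert (Hl := Him (s - d / 2) ltac:(lra)).
  assert (Hr := Him (s + d / 2) ltac:(lra)).
  assert (Hder : forall x, sigma (s - d / 2) <= x <= sigma (s + d / 2) ->
            derivable_pt S x).
  { intros x Hx. exists (f x). apply is_derive_Reals, HS.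
    apply (proj2 HJ (sigma (s - d / 2)) (sigma (s + d / 2))); auto;
      now apply inverse_spec. }
  assert (Hi : sigma (s - d / 2) <= sigma s <= sigma (s + d / 2)).
  { split; apply Rlt_le, Hinc; auto; lra. }
  assert (Ed : derive_pt S (sigma s) (Hder (sigma s) Hi) = f (sigma s)).
  { rewrite Derive_Reals. now apply is_derive_unique, HS. }
  apply is_derive_Reals. rewrite <- Ed, <- Rdiv_1_l.
  apply Ranalysis5.derivable_pt_lim_recip_interv; try lra.
  - apply continuity_pt_filterlim. now apply inverse_continuous.
  - intros x Hx. unfold comp, id. now apply inverse_spec, Him.
  - rewrite Ed. now apply Rgt_not_eq, Hpos.
Qed.

Lemma exists_inverse_of_primitive :
  exists (J' : R -> Prop) (sg : R -> R),
    open_interval J' /\ (forall s, J' s -> J (sg s)) /\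
    (forall t, J t -> exists s, J' s /\ sg s = t) /\
    forall s, J' s -> is_derive sg s (/ f (sg s)).
Proof.
  exists image, sigma. split; [exact image_open_interval|].
  split; [intros s Hs; now apply inverse_spec|].
  split; [|exact inverse_is_derive].
  intros t Ht. assert (Hi : image (S t)) by now exists t.
  exists (S t). split; [exact Hi|].
  apply injective_on_interval; auto; now apply inverse_spec.
Qed.

End Inverse.

(* The new parameter is a primitive of |f|^(-m). *)
Lemma exists_reparametrization (J : R -> Prop) (f : R -> R) (m : R) :
  open_interval J ->
  (forall t, J t -> f t <> 0 /\ ex_derive f t /\ continuous (Derive f) t) ->
  exists (J' : R -> Prop) (sg : R -> R),
    open_interval J' /\ reparametrization J' J sg /\
    forall s, J' s ->
      Derive_n sg 2 s = m * (Derive f (sg s) / f (sg s)) * Derive sg s ^ 2.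
Proof.
  intros HJ Hf.
  (* An empty interval has no base point for the primitive; there the identity satisfies everything
     vacuously. *)
  destruct (classic (exists t0, J t0)) as [[t0 Ht0]|Hempty]; cycle 1.
  { exists J, (fun t => t). split; [exact HJ|].
    assert (Hn : forall t, ~ J t) by (intros t Ht; apply Hempty; now exists t).
    split; [split|]; intros t Ht; now destruct (Hn t). }
  (* This is |f|^(-m), written through [f t ^ 2] so that it can be differentiated for either sign of
     [f]. *)
  set (g := fun t => exp (- m / 2 * ln (f t ^ 2))).
  assert (Hg : forall t, J t -> is_derive g t (- m * (Derive f t / f t) * g t)).
  { intros t Ht. destruct (Hf t Ht) as (H0 & H1 & _). unfold g.
    auto_derive.
    - repeat split; [exact H1|]. nra.
    - simpl. change (Derive (fun x => f x) t) with (Derive f t). field. exact H0. }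
  assert (gpos : forall t, 0 < g t) by (intros t; apply exp_pos).
  assert (gne : forall t, g t <> 0) by (intros t; apply Rgt_not_eq, gpos).
  destruct (exists_inverse_of_primitive J (RInt g t0) g HJ) as
    (J' & sg & HJ' & Hin & Hsurj & Hder).
  - apply open_interval_primitive; auto.
    intros t Ht. apply ex_derive_R_continuous. eexists. now apply Hg.
  - auto.
  (* The inverse of the primitive has derivative 1/g = |f|^m at [sg s], whose logarithmic derivative
     is m (f'/f) sg'. *)
  - assert (H2 : forall s, J' s -> is_derive (Derive sg) s
       (m * (Derive f (sg s) / f (sg s)) * (/ g (sg s)) ^ 2)).
    { intros s Hs.
      apply (is_derive_ext_loc (fun x => / g (sg x))).
      - generalize (proj1 HJ' s Hs). apply filter_imp.
        intros x Hx. symmetry. now apply is_derive_unique, Hder.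
      - assert (Hs' := Hin s Hs).
        replace (m * (Derive f (sg s) / f (sg s)) * (/ g (sg s)) ^ 2) with
          (- (/ g (sg s) * (- m * (Derive f (sg s) / f (sg s)) * g (sg s)))
           / g (sg s) ^ 2).
        + apply (is_derive_inv (fun x => g (sg x))); [|apply gne].
          apply is_derive_R_comp; [now apply Hg|now apply Hder].
        + assert (Hne := proj1 (Hf _ Hs')). field. auto. }
    assert (E1 : forall s, J' s -> Derive sg s = / g (sg s))
      by (intros s Hs; now apply is_derive_unique, Hder).
    assert (E2 : forall s, J' s -> Derive_n sg 2 s =
               m * (Derive f (sg s) / f (sg s)) * Derive sg s ^ 2).
    { intros s Hs. rewrite E1 by exact Hs. now apply is_derive_unique, H2. }
    exists J', sg. split; [exact HJ'|]. split; [|exact E2].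
    split; [|exact Hsurj].
    intros s Hs. assert (Hs' := Hin s Hs).
    split; [exact Hs'|]. split; [eexists; now apply Hder|].
    split; [eexists; now apply H2|]. split.
    + destruct (Hf _ Hs') as (Hne & Hd & Hc).
      apply (continuous_ext_loc _
        (fun x => m * (Derive f (sg x) / f (sg x)) * (Derive sg x * (Derive sg x * 1)))).
      * generalize (proj1 HJ' s Hs). apply filter_imp.
        intros x Hx. now rewrite E2.
      * assert (csg : continuous sg s)
          by (apply ex_derive_R_continuous; eexists; now apply Hder).
        assert (cdsg : continuous (Derive sg) s)
          by (apply ex_derive_R_continuous; eexists; now apply H2).
        apply (continuous_mult (fun x => m * (Derive f (sg x) / f (sg x)))
                (fun x => Derive sg x * (Derive sg x * 1))).
        -- apply (continuous_mult (fun _ => m) (fun x => Derive f (sg x) / f (sg x)));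
             [apply continuous_const|].
           apply (continuous_mult (fun x => Derive f (sg x)) (fun x => / f (sg x))).
           ++ now apply (continuous_comp sg (Derive f)).
           ++ apply continuous_Rinv_comp; [|exact Hne].
              apply (continuous_comp sg f); [exact csg|].
              now apply ex_derive_R_continuous.
        -- apply (continuous_mult (Derive sg) (fun x => Derive sg x * 1)); [exact cdsg|].
           apply (continuous_mult (Derive sg) (fun x => 1)); [exact cdsg|].
           apply continuous_const.
    + rewrite E1 by exact Hs. now apply Rinv_neq_0_compat, gne.
Qed.

(** * Second derivatives of composites and composition of reparametrizations *)

Lemma Derive_comp_loc (f g : R -> R) (s : R) :
  ex_derive g s -> locally (g s) (ex_derive f) ->
  locally s (ex_derive g) ->
  locally s (fun x => Derive (fun y => f (g y)) x = Derive g x * Derive f (g x)).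
Proof.
  intros Hs Hf Hg.
  assert (H : locally s (fun x => ex_derive f (g x)))
    by exact (ex_derive_R_continuous _ _ Hs _ Hf).
  generalize (filter_and _ _ H Hg). apply filter_imp. intros x [Hx Hx'].
  now apply Derive_comp.
Qed.

Lemma is_derive_Derive_comp (f g : R -> R) (s : R) :
  locally (g s) (ex_derive f) -> ex_derive (Derive f) (g s) ->
  locally s (ex_derive g) -> ex_derive (Derive g) s ->
  is_derive (Derive (fun y => f (g y))) s
    (Derive_n g 2 s * Derive f (g s) + Derive g s ^ 2 * Derive_n f 2 (g s)).
Proof.
  intros Hf Hf2 Hg Hg2.
  assert (Hgs := locally_singleton _ _ Hg).
  apply (is_derive_ext_loc (fun x => Derive g x * Derive f (g x))).
  - generalize (Derive_comp_loc f g s Hgs Hf Hg). apply filter_imp. now intros x ->.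
  - replace (Derive_n g 2 s * Derive f (g s) + Derive g s ^ 2 * Derive_n f 2 (g s))
      with (Derive (Derive g) s * Derive f (g s)
            + Derive g s * (Derive g s * Derive (Derive f) (g s)))
      by (change (Derive_n g 2 s) with (Derive (Derive g) s);
          change (Derive_n f 2 (g s)) with (Derive (Derive f) (g s)); ring).
    apply (is_derive_mult (Derive g) (fun x => Derive f (g x)));
      [now apply Derive_correct| |intros; apply Rmult_comm].
    apply is_derive_R_comp; now apply Derive_correct.
Qed.

Lemma reparametrization_comp (J' J I : R -> Prop) (tau sg : R -> R) :
  open_interval J -> open_interval J' ->
  reparametrization J I tau -> reparametrization J' J sg ->
  reparametrization J' I (fun s => tau (sg s)).
Proof.
  intros [oJ _] [oJ' _] [Ht Htsurj] [Hs Hssurj]. split.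
  - assert (D2 : forall s, J' s -> is_derive (Derive (fun y => tau (sg y))) s
      (Derive_n sg 2 s * Derive tau (sg s)
       + Derive sg s ^ 2 * Derive_n tau 2 (sg s))).
    { intros s H. destruct (Hs s H) as (Jt & Hs1 & Hs2 & _ & _).
      apply is_derive_Derive_comp; auto.
      - generalize (oJ _ Jt). apply filter_imp. intros x Hx. now apply Ht.
      - now apply Ht.
      - generalize (oJ' _ H). apply filter_imp. intros x Hx. now apply Hs. }
    intros s H.
    destruct (Hs s H) as (Jt & Hs1 & Hs2 & Hs3 & Hs4).
    destruct (Ht _ Jt) as (It & Ht1 & Ht2 & Ht3 & Ht4).
    split; [exact It|].
    split; [now apply ex_derive_comp|].
    split; [eexists; now apply D2|].
    split.
    + apply (continuous_ext_loc _ (fun s => Derive_n sg 2 s * Derive tau (sg s)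
       + (Derive sg s * (Derive sg s * 1)) * Derive_n tau 2 (sg s))).
      * generalize (oJ' _ H). apply filter_imp. intros x Hx.
        symmetry. now apply is_derive_unique, D2.
      * assert (csg := ex_derive_R_continuous _ _ Hs1).
        assert (cdsg := ex_derive_R_continuous _ _ Hs2).
        apply (continuous_plus (fun s => Derive_n sg 2 s * Derive tau (sg s))
          (fun s => (Derive sg s * (Derive sg s * 1)) * Derive_n tau 2 (sg s))).
        -- apply (continuous_mult (Derive_n sg 2) (fun s => Derive tau (sg s)));
             [exact Hs3|].
           apply (continuous_comp sg (Derive tau)); [exact csg|].
           now apply ex_derive_R_continuous.
        -- apply (continuous_mult (fun s => Derive sg s * (Derive sg s * 1))
              (fun s => Derive_n tau 2 (sg s))).
           ++ apply (continuous_mult (Derive sg) (fun x => Derive sg x * 1));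
                [exact cdsg|].
              apply (continuous_mult (Derive sg) (fun x => 1)); [exact cdsg|].
              apply continuous_const.
           ++ now apply (continuous_comp sg (Derive_n tau 2)).
    + rewrite Derive_comp by assumption. now apply Rmult_integral_contrapositive.
  - intros i Hi. destruct (Htsurj i Hi) as (t & HJt & <-).
    destruct (Hssurj t HJt) as (s & HJs & <-). now exists s.
Qed.

(** * Linear algebra *)

(** If the cross product vanished, each pair (q_i, - p_i) would be a linear relation between [p] and
    [q], so all coordinates would be zero, and then (1, 0) would be a nontrivial relation. *)
Lemma cross_product_neq_0 (p1 p2 p3 q1 q2 q3 : R) :
  (forall r s, r * p1 + s * q1 = 0 -> r * p2 + s * q2 = 0 ->
     r * p3 + s * q3 = 0 -> r = 0 /\ s = 0) ->
  0 < (p2 * q3 - p3 * q2) ^ 2 + (p3 * q1 - p1 * q3) ^ 2 + (p1 * q2 - p2 * q1) ^ 2.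
Proof.
  intros Hind.
  assert (H : forall x y z : R, 0 < x ^ 2 + y ^ 2 + z ^ 2 \/ (x = 0 /\ y = 0 /\ z = 0)).
  { intros x y z. destruct (Req_dec x 0); [destruct (Req_dec y 0);
      [destruct (Req_dec z 0); [now right|]|]|]; left; nra. }
  destruct (H (p2 * q3 - p3 * q2) (p3 * q1 - p1 * q3) (p1 * q2 - p2 * q1))
    as [Hp|(E1 & E2 & E3)]; [exact Hp|exfalso].
  assert (A1 := Hind q1 (- p1) ltac:(nra) ltac:(nra) ltac:(nra)).
  assert (A2 := Hind q2 (- p2) ltac:(nra) ltac:(nra) ltac:(nra)).
  assert (A3 := Hind q3 (- p3) ltac:(nra) ltac:(nra) ltac:(nra)).
  destruct (Hind 1 0); nra.
Qed.

(* [w] and [n] are both orthogonal to the plane spanned by [p] and [q], hence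
   parallel; as [n . m <> 0], the relation [w . m = 0] then forces [w = 0]. *)
Lemma orthogonal_to_basis_zero (p1 p2 p3 q1 q2 q3 n1 n2 n3 w1 w2 w3 m1 m2 m3 : R) :
  (forall r s, r * p1 + s * q1 = 0 -> r * p2 + s * q2 = 0 ->
     r * p3 + s * q3 = 0 -> r = 0 /\ s = 0) ->
  n1 * p1 + n2 * p2 + n3 * p3 = 0 -> n1 * q1 + n2 * q2 + n3 * q3 = 0 ->
  w1 * p1 + w2 * p2 + w3 * p3 = 0 -> w1 * q1 + w2 * q2 + w3 * q3 = 0 ->
  w1 * m1 + w2 * m2 + w3 * m3 = 0 -> n1 * m1 + n2 * m2 + n3 * m3 <> 0 ->
  w1 = 0 /\ w2 = 0 /\ w3 = 0.
Proof.
  intros Hind Np Nq Wp Wq Wm Nm.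
  assert (Hk := cross_product_neq_0 _ _ _ _ _ _ Hind).
  set (k1 := p2 * q3 - p3 * q2) in *. set (k2 := p3 * q1 - p1 * q3) in *.
  set (k3 := p1 * q2 - p2 * q1) in *.
  assert (P : forall x1 x2 x3, x1 * p1 + x2 * p2 + x3 * p3 = 0 ->
    (* Any vector orthogonal to [p] and [q] is parallel to their cross product; the parallelism is
       stated by vanishing minors, which avoids a scalar factor. *)
    x1 * q1 + x2 * q2 + x3 * q3 = 0 ->
    x1 * k2 = x2 * k1 /\ x1 * k3 = x3 * k1 /\ x2 * k3 = x3 * k2).
  { intros x1 x2 x3 Xp Xq. unfold k1, k2, k3. repeat split; nsatz. }
  destruct (P _ _ _ Np Nq) as (N1 & N2 & N3).
  destruct (P _ _ _ Wp Wq) as (W1 & W2 & W3).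
  clear P Np Nq Wp Wq Hind. clearbody k1 k2 k3.
  assert (Km : k1 * m1 + k2 * m2 + k3 * m3 <> 0).
  { intros E. apply Nm.
    assert (E1 : k1 * (n1 * m1 + n2 * m2 + n3 * m3) = 0) by nsatz.
    assert (E2 : k2 * (n1 * m1 + n2 * m2 + n3 * m3) = 0) by nsatz.
    assert (E3 : k3 * (n1 * m1 + n2 * m2 + n3 * m3) = 0) by nsatz.
    apply Rmult_integral in E1, E2, E3.
    destruct E1 as [E1|]; [|assumption]. destruct E2 as [E2|]; [|assumption].
    destruct E3 as [E3|]; [|assumption]. rewrite E1, E2, E3 in Hk. lra. }
  assert (Z : forall w k,
    w * (k1 * m1 + k2 * m2 + k3 * m3) = k * (w1 * m1 + w2 * m2 + w3 * m3) -> w = 0).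
  { intros w k E. rewrite Wm, Rmult_0_r in E.
    destruct (Rmult_integral _ _ E); [assumption|contradiction]. }
  clear Km Hk Nm.
  split; [apply (Z w1 k1)|split; [apply (Z w2 k2)|apply (Z w3 k3)]]; clear Z; nsatz.
Qed.

(** [gi] is the inverse matrix of [g], so contracting with one or the other passes between the
    systems; the lowered one is free of the determinant. With the coefficients abstract, [field]
    sees only atoms. *)
Lemma christoffel_system_lowered (g : idx -> idx -> R)
    (d : idx -> idx -> idx -> R) (x y : idx -> R) :
  let det := g I1 I1 * g I2 I2 - g I1 I2 * g I2 I1 in
  let gi k l := match k, l with
    | I1, I1 => g I2 I2 / det
    | I1, I2 => - g I1 I2 / det
    | I2, I1 => - g I2 I1 / det
    | I2, I2 => g I1 I1 / det
    end in
  g I1 I2 = g I2 I1 -> det <> 0 ->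
  (forall k, y k + sum2 (fun i => sum2 (fun j =>
     / 2 * sum2 (fun l => gi k l * (d i j l + d j i l - d l i j)) * x i * x j)) = 0)
  <->
  (forall l, sum2 (fun k => g k l * y k)
    + sum2 (fun i => sum2 (fun j =>
        (d i j l + d j i l - d l i j) / 2 * x i * x j)) = 0).
Proof.
  intros det gi Hsym Hdet. unfold gi, sum2. rewrite <- Hsym in *.
  split; intros H l; pose proof (H I1) as H1; pose proof (H I2) as H2;
    cbn beta iota in H1, H2; clear H;
    match type of H1 with ?f1 = 0 => set (e1 := f1) in H1 end;
    match type of H2 with ?f2 = 0 => set (e2 := f2) in H2 end; destruct l.
  - transitivity (g I1 I1 * e1 + g I1 I2 * e2); [|rewrite H1, H2; ring].
    unfold e1, e2, det in *. rewrite <- Hsym in *. field. exact Hdet.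
  - transitivity (g I1 I2 * e1 + g I2 I2 * e2); [|rewrite H1, H2; ring].
    unfold e1, e2, det in *. rewrite <- Hsym in *. field. exact Hdet.
  - transitivity ((g I2 I2 * e1 - g I1 I2 * e2) / det);
      [|rewrite H1, H2; field; exact Hdet].
    unfold e1, e2, det in *. rewrite <- Hsym in *. field. exact Hdet.
  - transitivity ((g I1 I1 * e2 - g I1 I2 * e1) / det);
      [|rewrite H1, H2; field; exact Hdet].
    unfold e1, e2, det in *. rewrite <- Hsym in *. field. exact Hdet.
Qed.

Lemma geodesic_equation_lowered (G : tensor) (phi : R -> R -> R3)
    (q : idx -> R -> R) (t : R) :
  gcoef G phi I1 I2 (q I1 t) (q I2 t) = gcoef G phi I2 I1 (q I1 t) (q I2 t) ->
  gdet G phi (q I1 t) (q I2 t) <> 0 ->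
  geodesic_equation G phi q t <->
  forall l, sum2 (fun k => gcoef G phi k l (q I1 t) (q I2 t) * Derive_n (q k) 2 t)
    + sum2 (fun i => sum2 (fun j =>
        (partial i (gcoef G phi j l) (q I1 t) (q I2 t)
         + partial j (gcoef G phi i l) (q I1 t) (q I2 t)
         - partial l (gcoef G phi i j) (q I1 t) (q I2 t)) / 2
        * Derive (q i) t * Derive (q j) t)) = 0.
Proof.
  exact (christoffel_system_lowered
    (fun i j => gcoef G phi i j (q I1 t) (q I2 t))
    (fun l i j => partial l (gcoef G phi i j) (q I1 t) (q I2 t))
    (fun k => Derive (q k) t) (fun k => Derive_n (q k) 2 t)).
Qed.

(** * Charts of the ellipsoid *)

(* The Gram determinant is minus the Minkowski square of [p x q], and [p x q]
   is parallel to [n]. *)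
Lemma minkowski_gram_det (p1 p2 p3 q1 q2 q3 n1 n2 n3 : R) :
  n1 * p1 + n2 * p2 + n3 * p3 = 0 -> n1 * q1 + n2 * q2 + n3 * q3 = 0 ->
  ((p1 * p1 + p2 * p2 - p3 * p3) * (q1 * q1 + q2 * q2 - q3 * q3)
   - (p1 * q1 + p2 * q2 - p3 * q3) * (q1 * p1 + q2 * p2 - q3 * p3))
  * (n1 ^ 2 + n2 ^ 2 + n3 ^ 2)
  = - ((p2 * q3 - p3 * q2) ^ 2 + (p3 * q1 - p1 * q3) ^ 2 + (p1 * q2 - p2 * q1) ^ 2)
    * (n1 ^ 2 + n2 ^ 2 - n3 ^ 2).
Proof.
  intros Hp Hq.
  set (k1 := p2 * q3 - p3 * q2). set (k2 := p3 * q1 - p1 * q3).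
  set (k3 := p1 * q2 - p2 * q1).
  (* These relations express that [k] is parallel to [n]. The two sides of the final identity differ
     by exactly twice the sum of the two squared relations, so [lra] concludes. *)
  assert (N1 : (n1 * k3) ^ 2 = (n3 * k1) ^ 2) by (f_equal; unfold k1, k3; nsatz).
  assert (N2 : (n2 * k3) ^ 2 = (n3 * k2) ^ 2) by (f_equal; unfold k2, k3; nsatz).
  transitivity ((k3 ^ 2 - k1 ^ 2 - k2 ^ 2) * (n1 ^ 2 + n2 ^ 2 + n3 ^ 2)).
  - unfold k1, k2, k3. ring.
  - clearbody k1 k2 k3. lra.
Qed.

(** * Velocity, acceleration and normal form in a chart *)

Definition velocity (f : R -> R -> R) (q : idx -> R -> R) (t : R) : R :=
  sum2 (fun k => partial k f (q I1 t) (q I2 t) * Derive (q k) t).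

(** The formula for the second derivative along the curve, taken as a definition: it is algebraic in
    the derivatives of [q] at the instant [t], as the geodesic equation is. *)
Definition acceleration (f : R -> R -> R) (q : idx -> R -> R) (t : R) : R :=
  sum2 (fun k => partial k f (q I1 t) (q I2 t) * Derive_n (q k) 2 t)
  + sum2 (fun i => sum2 (fun j =>
      partial i (partial j f) (q I1 t) (q I2 t) * Derive (q i) t * Derive (q j) t)).

Section Ellipsoid.

Variables a b c : R.
Hypotheses (ha : 0 < a) (hb : 0 < b) (hc : 0 < c).

Definition tropic_velocity (phi : R -> R -> R3) (q : idx -> R -> R) (t : R) : R :=
  let p := phi (q I1 t) (q I2 t) in
  2 * (cx p * velocity (fun u v => cx (phi u v)) q t / a ^ 2
       + cy p * velocity (fun u v => cy (phi u v)) q t / b ^ 2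
       - cz p * velocity (fun u v => cz (phi u v)) q t / c ^ 2).

Definition quad_velocity (phi : R -> R -> R3) (q : idx -> R -> R) (t : R) : R :=
  velocity (fun u v => cx (phi u v)) q t ^ 2 / a
  + velocity (fun u v => cy (phi u v)) q t ^ 2 / b
  + velocity (fun u v => cz (phi u v)) q t ^ 2 / c.

(* With F the tropic function, Q the quadratic form [quad_velocity] and N the
   Minkowski normal (x/a, y/b, -z/c), this is gamma'' = m (F'/F) gamma' - (Q/F) N. *)
Definition normal_form (m : R) (phi : R -> R -> R3) (q : idx -> R -> R) (t : R) : Prop :=
  let p := phi (q I1 t) (q I2 t) in
  let F := tropic_fun a b c p in
  let r := m * (tropic_velocity phi q t / F) in
  let s := quad_velocity phi q t / F in
  acceleration (fun u v => cx (phi u v)) q t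
    = r * velocity (fun u v => cx (phi u v)) q t - s * (cx p / a) /\
  acceleration (fun u v => cy (phi u v)) q t
    = r * velocity (fun u v => cy (phi u v)) q t - s * (cy p / b) /\
  acceleration (fun u v => cz (phi u v)) q t
    = r * velocity (fun u v => cz (phi u v)) q t + s * (cz p / c).

Section Chart.

Variables (U : R * R -> Prop) (phi : R -> R -> R3).
Hypothesis Hphi : local_parametrization (ellipsoid_off_tropics a b c) U phi.

Let X u v := cx (phi u v).
Let Y u v := cy (phi u v).
Let Z u v := cz (phi u v).
Let F u v := tropic_fun a b c (phi u v).

Let oU : open U := lp_open _ _ _ Hphi.
Let sX : smooth_on U X := lp_smooth_x _ _ _ Hphi.
Let sY : smooth_on U Y := lp_smooth_y _ _ _ Hphi.
Let sZ : smooth_on U Z := lp_smooth_z _ _ _ Hphi.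

(** That [phi] maps into the surface is contained in the homeomorphism clause, applied to [U]
    itself. *)
Lemma chart_on_surface u v : U (u, v) -> ellipsoid_off_tropics a b c (phi u v).
Proof.
  intros H. destruct (lp_homeo _ _ _ Hphi U oU (fun _ h => h)) as (V & _ & HV).
  apply (HV (phi u v)). now exists u, v.
Qed.

Lemma chart_tropic_neq_0 u v : U (u, v) -> F u v <> 0.
Proof. intros H. now apply chart_on_surface. Qed.

Lemma chart_tangent i u v : U (u, v) ->
  X u v / a * partial i X u v + Y u v / b * partial i Y u v
  + Z u v / c * partial i Z u v = 0.
Proof.
  intros HU.
  assert (H := is_partial_locally_const U oU i
    (fun s t => / a * (X s t * X s t) + / b * (Y s t * Y s t)
     + / c * (Z s t * Z s t)) 1 u v HU).
  assert (H' := H ltac:(intros s t Hst; rewrite <- (proj1 (chart_on_surface s t Hst));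
                unfold X, Y, Z; field; lra) _
     (is_partial_bilinear U i _ _ _ X X Y Y Z Z u v HU sX sX sY sY sZ sZ)).
  lra.
Qed.

(** Derivative of the tangency relation: the tangent components determine the normal component of
    the second partial derivatives, as a second fundamental form does. *)
Lemma chart_tangent_partial i j u v : U (u, v) ->
  partial i X u v * partial j X u v / a + partial i Y u v * partial j Y u v / b
  + partial i Z u v * partial j Z u v / c
  + (X u v / a * partial i (partial j X) u v + Y u v / b * partial i (partial j Y) u v
     + Z u v / c * partial i (partial j Z) u v) = 0.
Proof.
  intros HU.
  assert (H := is_partial_locally_const U oU i
    (fun s t => / a * (X s t * partial j X s t) + / b * (Y s t * partial j Y s t)
     + / c * (Z s t * partial j Z s t)) 0 u v HU).
  assert (H' := H ltac:(intros s t Hst; rewrite <- (chart_tangent j s t Hst); field; lra) _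
     (is_partial_bilinear U i _ _ _ X (partial j X) Y (partial j Y) Z (partial j Z) u v HU
      sX (smooth_on_partial U X j sX) sY (smooth_on_partial U Y j sY)
      sZ (smooth_on_partial U Z j sZ))).
  rewrite <- H'. field. lra.
Qed.

Lemma chart_tropic_smooth : smooth_on U F.
Proof.
  apply (smooth_on_ext U oU (fun s t => / a ^ 2 * (X s t * X s t)
     + / b ^ 2 * (Y s t * Y s t) + - / c ^ 2 * (Z s t * Z s t))).
  - intros s t _. unfold F, tropic_fun, X, Y, Z. field. lra.
  - now apply (smooth_on_bilinear U oU).
Qed.

Lemma chart_tropic_partial i u v : U (u, v) ->
  is_partial i F u v (2 * (X u v * partial i X u v / a ^ 2
    + Y u v * partial i Y u v / b ^ 2 - Z u v * partial i Z u v / c ^ 2)).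
Proof.
  intros HU.
  apply (is_partial_ext_loc i (fun s t => / a ^ 2 * (X s t * X s t)
     + / b ^ 2 * (Y s t * Y s t) + - / c ^ 2 * (Z s t * Z s t))).
  - apply locally_2d_forall. intros s t. unfold F, tropic_fun, X, Y, Z. field. lra.
  - assert (H := is_partial_bilinear U i (/ a ^ 2) (/ b ^ 2) (- / c ^ 2) X X Y Y Z Z u v
      HU sX sX sY sY sZ sZ).
    match type of H with is_partial _ _ _ _ ?l => match goal with
      |- is_partial _ _ _ _ ?l' => replace l' with l; [exact H|field; lra] end end.
Qed.

Lemma chart_independent u v : U (u, v) -> forall r s : R,
  r * partial I1 X u v + s * partial I2 X u v = 0 ->
  r * partial I1 Y u v + s * partial I2 Y u v = 0 ->
  r * partial I1 Z u v + s * partial I2 Z u v = 0 ->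
  r = 0 /\ s = 0.
Proof. exact (lp_immersion _ _ _ Hphi u v). Qed.

(** * Coefficients of the two metrics and their nondegeneracy *)

Lemma minkowski_gcoefE i j u v : gcoef minkowski phi i j u v =
  partial i X u v * partial j X u v + partial i Y u v * partial j Y u v
  - partial i Z u v * partial j Z u v.
Proof. reflexivity. Qed.

Lemma ds2_gcoefE i j u v : gcoef (ds2 a b c) phi i j u v =
  (partial i X u v * partial j X u v / a + partial i Y u v * partial j Y u v / b
   + partial i Z u v * partial j Z u v / c) / Rabs (F u v).
Proof. reflexivity. Qed.

Lemma minkowski_gcoef_smooth i j : smooth_on U (gcoef minkowski phi i j).
Proof.
  apply (smooth_on_ext U oU (fun s t => 1 * (partial i X s t * partial j X s t)
    + 1 * (partial i Y s t * partial j Y s t)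
    + -1 * (partial i Z s t * partial j Z s t))).
  - intros s t _. rewrite minkowski_gcoefE. ring.
  - apply (smooth_on_bilinear U oU); now apply smooth_on_partial.
Qed.

(** The Minkowski square of the Euclidean normal is the tropic function, so a zero of the Gram
    determinant would have to be a tropic point. *)
Lemma minkowski_gdet_neq_0 u v : U (u, v) -> gdet minkowski phi u v <> 0.
Proof.
  intros HU E.
  assert (H := minkowski_gram_det _ _ _ _ _ _ _ _ _
    (chart_tangent I1 u v HU) (chart_tangent I2 u v HU)).
  assert (Hk := cross_product_neq_0 _ _ _ _ _ _ (chart_independent u v HU)).
  assert (HF := chart_tropic_neq_0 u v HU).
  assert (EF : (X u v / a) ^ 2 + (Y u v / b) ^ 2 - (Z u v / c) ^ 2 = F u v).
  { unfold F, tropic_fun, X, Y, Z. field. lra. }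
  rewrite EF in H.
  match type of H with ?d * _ = _ => change d with (gdet minkowski phi u v) in H end.
  rewrite E, Rmult_0_l in H. symmetry in H.
  apply Rmult_integral in H. destruct H as [H|H]; [lra|contradiction].
Qed.

Lemma ds2_gcoef_smooth i j : smooth_on U (gcoef (ds2 a b c) phi i j).
Proof.
  apply (smooth_on_ext U oU (fun s t => (/ a * (partial i X s t * partial j X s t)
    + / b * (partial i Y s t * partial j Y s t)
    + / c * (partial i Z s t * partial j Z s t)) * / Rabs (F s t))).
  - intros s t Hst. rewrite ds2_gcoefE. field.
    repeat split; try lra. now apply Rabs_no_R0, chart_tropic_neq_0.
  - apply (smooth_on_mult U oU (fun s t => / a * (partial i X s t * partial j X s t)
      + / b * (partial i Y s t * partial j Y s t)
      + / c * (partial i Z s t * partial j Z s t)) (fun s t => / Rabs (F s t))).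
    + apply (smooth_on_bilinear U oU); now apply smooth_on_partial.
    + apply (smooth_on_inv U oU (fun s t => Rabs (F s t))).
      * intros u v HU. now apply Rabs_no_R0, chart_tropic_neq_0.
      * apply (smooth_on_Rabs U oU); [exact chart_tropic_neq_0|exact chart_tropic_smooth].
Qed.

Lemma ds2_positive u v (xi : idx -> R) : U (u, v) -> (exists i, xi i <> 0) ->
  0 < sum2 (fun i => sum2 (fun j => gcoef (ds2 a b c) phi i j u v * xi i * xi j)).
Proof.
  intros HU Hxi.
  assert (HF : 0 < Rabs (F u v)) by now apply Rabs_pos_lt, chart_tropic_neq_0.
  (* The image of [xi] in the ambient space: the form is a positive weighted sum of its squared
     coordinates, and they vanish together only if [xi] does. *)
  set (w f := xi I1 * partial I1 f u v + xi I2 * partial I2 f u v).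
  replace (sum2 _) with ((w X ^ 2 / a + w Y ^ 2 / b + w Z ^ 2 / c) / Rabs (F u v)).
  2:{ unfold sum2, w. rewrite !ds2_gcoefE.
      field. lra. }
  apply Rdiv_lt_0_compat; [|exact HF].
  assert (Pa := fun x : R => Rmult_le_pos _ _ (pow2_ge_0 x) (Rlt_le _ _ (Rinv_0_lt_compat _ ha))).
  assert (Pb := fun x : R => Rmult_le_pos _ _ (pow2_ge_0 x) (Rlt_le _ _ (Rinv_0_lt_compat _ hb))).
  assert (Pc := fun x : R => Rmult_le_pos _ _ (pow2_ge_0 x) (Rlt_le _ _ (Rinv_0_lt_compat _ hc))).
  assert (P : forall x k, x <> 0 -> 0 < k -> 0 < x ^ 2 / k).
  { intros x k Hx Hk. apply Rdiv_lt_0_compat; [|exact Hk]. nra. }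
  assert (QX := Pa (w X)). assert (QY := Pb (w Y)). assert (QZ := Pc (w Z)).
  destruct (Req_dec (w X) 0) as [EX|NX]; [|specialize (P _ a NX ha); lra].
  destruct (Req_dec (w Y) 0) as [EY|NY]; [|specialize (P _ b NY hb); lra].
  destruct (Req_dec (w Z) 0) as [EZ|NZ]; [|specialize (P _ c NZ hc); lra].
  exfalso. destruct (chart_independent u v HU _ _ EX EY EZ) as [E1 E2].
  destruct Hxi as [[|] Hi]; contradiction.
Qed.

Lemma ds2_gcoef_sym i j u v :
  gcoef (ds2 a b c) phi i j u v = gcoef (ds2 a b c) phi j i u v.
Proof. rewrite !ds2_gcoefE. unfold Rdiv. ring. Qed.

Lemma minkowski_gcoef_sym i j u v :
  gcoef minkowski phi i j u v = gcoef minkowski phi j i u v.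
Proof. unfold gcoef, minkowski. ring. Qed.

Lemma ds2_gdet_neq_0 u v : U (u, v) -> gdet (ds2 a b c) phi u v <> 0.
Proof.
  intros HU E. unfold gdet in E.
  assert (S := ds2_gcoef_sym I1 I2 u v).
  assert (H1 := ds2_positive u v (fun i => match i with I1 => 1 | I2 => 0 end) HU
     (ex_intro _ I1 R1_neq_R0)).
  (* On the vector (- g12, g11) the form takes the value g11 times the determinant. *)
  assert (H2 := ds2_positive u v (fun i => match i with
      I1 => - gcoef (ds2 a b c) phi I1 I2 u v | I2 => gcoef (ds2 a b c) phi I1 I1 u v end) HU).
  unfold sum2 in H1, H2. rewrite <- S in E, H1, H2.
  assert (H3 : 0 < gcoef (ds2 a b c) phi I1 I1 u v) by lra.
  specialize (H2 (ex_intro _ I2 (Rgt_not_eq _ _ H3))). nra.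
Qed.

Lemma minkowski_gcoef_partial l i j u v : U (u, v) ->
  partial l (gcoef minkowski phi i j) u v =
  partial l (partial i X) u v * partial j X u v + partial i X u v * partial l (partial j X) u v
  + (partial l (partial i Y) u v * partial j Y u v + partial i Y u v * partial l (partial j Y) u v)
  - (partial l (partial i Z) u v * partial j Z u v + partial i Z u v * partial l (partial j Z) u v).
Proof.
  intros HU. apply is_partial_unique.
  apply (is_partial_ext_loc l (fun s t => 1 * (partial i X s t * partial j X s t)
    + 1 * (partial i Y s t * partial j Y s t)
    + -1 * (partial i Z s t * partial j Z s t))).
  - apply locally_2d_forall. intros s t. rewrite minkowski_gcoefE. ring.
  - assert (H := is_partial_bilinear U l 1 1 (-1) (partial i X) (partial j X) (partial i Y)
      (partial j Y) (partial i Z) (partial j Z) u v HU).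
    match type of H with _ -> _ -> _ -> _ -> _ -> _ -> is_partial _ _ _ _ ?l => match goal with
      |- is_partial _ _ _ _ ?l' => replace l' with l by ring end end.
    apply H; now apply smooth_on_partial.
Qed.

Lemma ds2_gcoef_partial l i j u v : U (u, v) ->
  partial l (gcoef (ds2 a b c) phi i j) u v =
  ((partial l (partial i X) u v * partial j X u v
    + partial i X u v * partial l (partial j X) u v) / a
   + (partial l (partial i Y) u v * partial j Y u v
    + partial i Y u v * partial l (partial j Y) u v) / b
   + (partial l (partial i Z) u v * partial j Z u v
    + partial i Z u v * partial l (partial j Z) u v) / c
   - (partial i X u v * partial j X u v / a + partial i Y u v * partial j Y u v / b
      + partial i Z u v * partial j Z u v / c)
     * (2 * (X u v * partial l X u v / a ^ 2
        + Y u v * partial l Y u v / b ^ 2 - Z u v * partial l Z u v / c ^ 2))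
     / F u v) / Rabs (F u v).
Proof.
  intros HU. apply is_partial_unique.
  assert (HF := chart_tropic_neq_0 u v HU).
  set (B := fun s t => / a * (partial i X s t * partial j X s t)
    + / b * (partial i Y s t * partial j Y s t)
    + / c * (partial i Z s t * partial j Z s t)).
  apply (is_partial_ext_loc l (fun s t => B s t * / Rabs (F s t))).
  - generalize (open_locally_2d _ _ _ oU HU). apply locally_2d_impl.
    apply locally_2d_forall. intros s t Hst. unfold B. rewrite ds2_gcoefE. field.
    repeat split; try lra. now apply Rabs_no_R0, chart_tropic_neq_0.
  - assert (HB := is_partial_bilinear U l (/ a) (/ b) (/ c) (partial i X) (partial j X)
      (partial i Y) (partial j Y) (partial i Z) (partial j Z) u v HU
      (smooth_on_partial U X i sX) (smooth_on_partial U X j sX)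
      (smooth_on_partial U Y i sY) (smooth_on_partial U Y j sY)
      (smooth_on_partial U Z i sZ) (smooth_on_partial U Z j sZ)).
    assert (HR := is_partial_inv l (fun s t => Rabs (F s t)) u v _
      (is_partial_Rabs l F u v _ (chart_tropic_partial l u v HU) HF) (Rabs_no_R0 _ HF)).
    assert (H := is_partial_mult l B (fun s t => / Rabs (F s t)) u v _ _ HB HR).
    cbv beta in H.
    match type of H with is_partial _ _ _ _ ?l => match goal with
      |- is_partial _ _ _ _ ?l' => replace l' with l; [exact H|] end end.
    unfold B. clear H HR HB B.
    (* For either sign the derivative of 1/|F| is - F'/(F |F|). *)
    destruct (Rle_or_lt (F u v) 0).
    + rewrite sign_eq_m1, Rabs_left by lra. field. lra.
    + rewrite sign_eq_1, Rabs_right by lra. field. lra.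
Qed.

(** * Equivalence of the geodesic equations with the normal forms *)

Lemma chart_acceleration_normal q t : U (q I1 t, q I2 t) ->
  X (q I1 t) (q I2 t) / a * acceleration X q t
  + Y (q I1 t) (q I2 t) / b * acceleration Y q t
  + Z (q I1 t) (q I2 t) / c * acceleration Z q t = - quad_velocity phi q t.
Proof.
  intros HU. unfold quad_velocity. fold X Y Z. unfold acceleration, velocity, sum2.
  assert (T1 := chart_tangent I1 _ _ HU). assert (T2 := chart_tangent I2 _ _ HU).
  assert (S11 := chart_tangent_partial I1 I1 _ _ HU).
  assert (S12 := chart_tangent_partial I1 I2 _ _ HU).
  assert (S21 := chart_tangent_partial I2 I1 _ _ HU).
  assert (S22 := chart_tangent_partial I2 I2 _ _ HU).
  apply Rminus_diag_uniq.
  (* The tangency relations are weighted by the second derivatives of [q], their derivatives by the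
     products of first derivatives, as in the formula for the acceleration. *)
  match type of T1 with ?t1 = 0 => match type of T2 with ?t2 = 0 =>
  match type of S11 with ?s11 = 0 => match type of S12 with ?s12 = 0 =>
  match type of S21 with ?s21 = 0 => match type of S22 with ?s22 = 0 =>
  transitivity (t1 * Derive_n (q I1) 2 t + t2 * Derive_n (q I2) 2 t
    + s11 * Derive (q I1) t ^ 2 + s12 * Derive (q I1) t * Derive (q I2) t
    + s21 * Derive (q I1) t * Derive (q I2) t + s22 * Derive (q I2) t ^ 2)
  end end end end end end.
  - field. lra.
  - rewrite T1, T2, S11, S12, S21, S22. ring.
Qed.

Lemma minkowski_geodesic_normal_form q t : U (q I1 t, q I2 t) ->
  geodesic_equation minkowski phi q t <-> normal_form 0 phi q t.
Proof.
  intros HU.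
  rewrite geodesic_equation_lowered;
    [|apply minkowski_gcoef_sym|now apply minkowski_gdet_neq_0].
  (* The lowered equation says that the acceleration is Minkowski-orthogonal to the surface.
     Symmetry of second partials cancels the terms not paired with the direction [l]. *)
  assert (E : forall l, sum2 (fun k => gcoef minkowski phi k l (q I1 t) (q I2 t) * Derive_n (q k) 2 t)
    + sum2 (fun i => sum2 (fun j =>
        (partial i (gcoef minkowski phi j l) (q I1 t) (q I2 t)
         + partial j (gcoef minkowski phi i l) (q I1 t) (q I2 t)
         - partial l (gcoef minkowski phi i j) (q I1 t) (q I2 t)) / 2
        * Derive (q i) t * Derive (q j) t)) =
    partial l X (q I1 t) (q I2 t) * acceleration X q t
    + partial l Y (q I1 t) (q I2 t) * acceleration Y q t
    - partial l Z (q I1 t) (q I2 t) * acceleration Z q t).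
  { intros l. unfold acceleration, sum2.
    rewrite !minkowski_gcoef_partial by exact HU. rewrite !minkowski_gcoefE.
    assert (CX := smooth_on_partial_comm U oU X _ _ sX HU).
    assert (CY := smooth_on_partial_comm U oU Y _ _ sY HU).
    assert (CZ := smooth_on_partial_comm U oU Z _ _ sZ HU).
    destruct l; rewrite CX, CY, CZ; field. }
  assert (HF := chart_tropic_neq_0 _ _ HU).
  assert (Hn := chart_acceleration_normal q t HU).
  assert (T := fun i => chart_tangent i _ _ HU).
  assert (EF : F (q I1 t) (q I2 t) = (X (q I1 t) (q I2 t) / a) ^ 2
     + (Y (q I1 t) (q I2 t) / b) ^ 2 - (Z (q I1 t) (q I2 t) / c) ^ 2).
  { unfold F, tropic_fun, X, Y, Z. field. lra. }
  unfold normal_form. fold X Y Z.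
  change (tropic_fun a b c (phi (q I1 t) (q I2 t))) with (F (q I1 t) (q I2 t)).
  change (cx (phi (q I1 t) (q I2 t))) with (X (q I1 t) (q I2 t)).
  change (cy (phi (q I1 t) (q I2 t))) with (Y (q I1 t) (q I2 t)).
  change (cz (phi (q I1 t) (q I2 t))) with (Z (q I1 t) (q I2 t)).
  cbv zeta.
  set (s := quad_velocity phi q t / F (q I1 t) (q I2 t)).
  assert (Es : quad_velocity phi q t = s * F (q I1 t) (q I2 t)) by (unfold s; now field).
  assert (Ts := fun i => f_equal (Rmult s) (T i)). cbv beta in Ts.
  rewrite !Rmult_0_l.
  split.
  - intros H.
    assert (H1 := H I1). assert (H2 := H I2). rewrite E in H1, H2.
    (* The third coordinate of the defect changes sign to turn the Minkowski product into a
       Euclidean one. The test vector is N: its product with the defect is - Q + s F = 0, and n . N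
       = F is not zero. *)
    destruct (orthogonal_to_basis_zero _ _ _ _ _ _
      (X (q I1 t) (q I2 t) / a) (Y (q I1 t) (q I2 t) / b) (Z (q I1 t) (q I2 t) / c)
      (acceleration X q t + s * (X (q I1 t) (q I2 t) / a))
      (acceleration Y q t + s * (Y (q I1 t) (q I2 t) / b))
      (- (acceleration Z q t - s * (Z (q I1 t) (q I2 t) / c)))
      (X (q I1 t) (q I2 t) / a) (Y (q I1 t) (q I2 t) / b) (- (Z (q I1 t) (q I2 t) / c))
      (chart_independent _ _ HU) (T I1) (T I2)) as (A1 & A2 & A3).
    + specialize (Ts I1). lra.
    + specialize (Ts I2). lra.
    + rewrite Es, EF in Hn. lra.
    + intros E0. apply HF. rewrite EF. lra.
    + repeat split; lra.
  - intros (A1 & A2 & A3) l. rewrite E, A1, A2, A3. specialize (Ts l). lra.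
Qed.

Lemma ds2_geodesic_normal_form q t : U (q I1 t, q I2 t) ->
  geodesic_equation (ds2 a b c) phi q t <-> normal_form 1 phi q t.
Proof.
  intros HU.
  rewrite geodesic_equation_lowered;
    [|apply ds2_gcoef_sym|now apply ds2_gdet_neq_0].
  assert (HF := chart_tropic_neq_0 _ _ HU).
  assert (HR := Rabs_no_R0 _ HF).
  set (u := q I1 t) in *. set (v := q I2 t) in *.
  set (r := tropic_velocity phi q t / F u v).
  set (s := quad_velocity phi q t / F u v).
  (* The vector ([w1], [w2], [w3]) is the defect of the normal form with m = 1. *)
  set (w1 := acceleration X q t - r * velocity X q t + s * (X u v / a)).
  set (w2 := acceleration Y q t - r * velocity Y q t + s * (Y u v / b)).
  set (w3 := acceleration Z q t - r * velocity Z q t - s * (Z u v / c)).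
  assert (E : forall l, sum2 (fun k => gcoef (ds2 a b c) phi k l u v * Derive_n (q k) 2 t)
    + sum2 (fun i => sum2 (fun j =>
        (partial i (gcoef (ds2 a b c) phi j l) u v
         + partial j (gcoef (ds2 a b c) phi i l) u v
         - partial l (gcoef (ds2 a b c) phi i j) u v) / 2
        * Derive (q i) t * Derive (q j) t)) =
    (w1 / a * partial l X u v + w2 / b * partial l Y u v + w3 / c * partial l Z u v)
    / Rabs (F u v)).
  { intros l. unfold w1, w2, w3, r, s, quad_velocity, tropic_velocity. fold X Y Z.
    change (cx (phi (q I1 t) (q I2 t))) with (X u v).
    change (cy (phi (q I1 t) (q I2 t))) with (Y u v).
    change (cz (phi (q I1 t) (q I2 t))) with (Z u v).
    unfold velocity, acceleration, sum2. fold u v.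
    rewrite !ds2_gcoef_partial by exact HU. rewrite !ds2_gcoefE.
    assert (CX := smooth_on_partial_comm U oU X _ _ sX HU).
    assert (CY := smooth_on_partial_comm U oU Y _ _ sY HU).
    assert (CZ := smooth_on_partial_comm U oU Z _ _ sZ HU).
    destruct l; rewrite CX, CY, CZ; field; repeat split; try lra; assumption. }
  assert (Hn := chart_acceleration_normal q t HU). fold u v in Hn.
  assert (T := fun i => chart_tangent i _ _ HU).
  assert (EF : F u v = (X u v / a) ^ 2 + (Y u v / b) ^ 2 - (Z u v / c) ^ 2).
  { unfold F, tropic_fun, X, Y, Z. field. lra. }
  assert (Es : quad_velocity phi q t = s * F u v) by (unfold s; now field).
  assert (EN : normal_form 1 phi q t <-> w1 = 0 /\ w2 = 0 /\ w3 = 0).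
  { unfold normal_form. fold X Y Z u v.
    change (tropic_fun a b c (phi u v)) with (F u v).
    change (cx (phi u v)) with (X u v). change (cy (phi u v)) with (Y u v).
    change (cz (phi u v)) with (Z u v). cbv zeta. fold r s.
    unfold w1, w2, w3. rewrite !Rmult_1_l. split; intros (A1 & A2 & A3); repeat split; lra. }
  rewrite EN.
  assert (Tv : X u v / a * velocity X q t + Y u v / b * velocity Y q t
     + Z u v / c * velocity Z q t = 0).
  { unfold velocity, sum2. fold u v. assert (T1 := f_equal (Rmult (Derive (q I1) t)) (T I1)).
    assert (T2 := f_equal (Rmult (Derive (q I2) t)) (T I2)). lra. }
  assert (Hell : X u v / a * X u v + Y u v / b * Y u v + Z u v / c * Z u v = 1).
  { rewrite <- (proj1 (chart_on_surface _ _ HU)). unfold X, Y, Z. field. lra. }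
  split.
  - intros H.
    assert (H' : forall l, w1 / a * partial l X u v + w2 / b * partial l Y u v
      + w3 / c * partial l Z u v = 0).
    { intros l. specialize (H l). rewrite E in H.
      apply (Rmult_eq_reg_r (/ Rabs (F u v))); [|now apply Rinv_neq_0_compat].
      rewrite Rmult_0_l. exact H. }
    (* Here the test vector is the position itself: n . gamma = 1, and pairing the rescaled defect
       with gamma gives n . w = 0. *)
    destruct (orthogonal_to_basis_zero _ _ _ _ _ _
      (X u v / a) (Y u v / b) (Z u v / c) (w1 / a) (w2 / b) (w3 / c)
      (X u v) (Y u v) (Z u v)
      (chart_independent _ _ HU) (T I1) (T I2) (H' I1) (H' I2)) as (A1 & A2 & A3).
    + transitivity (X u v / a * w1 + Y u v / b * w2 + Z u v / c * w3); [field; lra|].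
      unfold w1, w2, w3. rewrite Es, EF in Hn.
      assert (Tr := f_equal (Rmult r) Tv). lra.
    + lra.
    + assert (D : forall x k, 0 < k -> x / k = 0 -> x = 0).
      { intros x k Hk Hx. replace x with (x / k * k) by (field; lra). rewrite Hx. ring. }
      split; [apply (D _ a)|split; [apply (D _ b)|apply (D _ c)]]; assumption.
  - intros (A1 & A2 & A3) l. rewrite E, A1, A2, A3. unfold Rdiv. ring.
Qed.

End Chart.
End Ellipsoid.

(** * Transfer of unparametrized geodesics *)

Lemma velocity_reparam f (q : idx -> R -> R) (sg : R -> R) s :
  (forall k, Derive (fun x => q k (sg x)) s = Derive sg s * Derive (q k) (sg s)) ->
  velocity f (fun k x => q k (sg x)) s = Derive sg s * velocity f q (sg s).
Proof. intros H. unfold velocity, sum2. rewrite !H. ring. Qed.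

Lemma acceleration_reparam f (q : idx -> R -> R) (sg : R -> R) s :
  (forall k, Derive (fun x => q k (sg x)) s = Derive sg s * Derive (q k) (sg s)) ->
  (forall k, Derive_n (fun x => q k (sg x)) 2 s =
     Derive_n sg 2 s * Derive (q k) (sg s)
     + Derive sg s ^ 2 * Derive_n (q k) 2 (sg s)) ->
  acceleration f (fun k x => q k (sg x)) s =
    Derive_n sg 2 s * velocity f q (sg s) + Derive sg s ^ 2 * acceleration f q (sg s).
Proof.
  intros H H2. unfold acceleration, velocity, sum2. rewrite !H, !H2. ring.
Qed.

Lemma velocity_is_derive (U : R * R -> Prop) f (q : idx -> R -> R) t :
  open U -> smooth_on U f -> U (q I1 t, q I2 t) -> (forall k, ex_derive (q k) t) ->
  is_derive (fun s => f (q I1 s) (q I2 s)) t (velocity f q t).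
Proof.
  intros oU Hf HU Hq.
  apply (smooth_on_chain_rule U oU f q (fun k => Derive (q k) t)); auto.
  intros k. now apply Derive_correct.
Qed.

Lemma velocity_ex_derive (U : R * R -> Prop) f (q : idx -> R -> R) t :
  open U -> smooth_on U f -> U (q I1 t, q I2 t) ->
  (forall k, ex_derive (q k) t /\ ex_derive (Derive (q k)) t) ->
  ex_derive (velocity f q) t.
Proof.
  intros oU Hf HU Hq.
  assert (H : forall k, ex_derive
    (fun s => partial k f (q I1 s) (q I2 s) * Derive (q k) s) t).
  { intros k.
    apply (ex_derive_mult (fun s => partial k f (q I1 s) (q I2 s)) (Derive (q k)));
      [|exact (proj2 (Hq k))].
    eexists. apply (velocity_is_derive U); auto.
    - now apply smooth_on_partial.
    - intros j. exact (proj1 (Hq j)). }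
  apply (ex_derive_plus (fun s => partial I1 f (q I1 s) (q I2 s) * Derive (q I1) s)
    (fun s => partial I2 f (q I1 s) (q I2 s) * Derive (q I2) s)); apply H.
Qed.

Section Reparametrization.

Variables a b c : R.
Hypotheses (ha : 0 < a) (hb : 0 < b) (hc : 0 < c).

(** The normal term is quadratic in the velocity, so it scales by sg'^2 like the acceleration; the
    tangential coefficient becomes sg'' + m (F'/F) sg'^2, which the assumption on sg'' turns into m'
    (F'/F) sg'^2. *)
Lemma normal_form_reparam m m' phi (q : idx -> R -> R) (sg : R -> R) s :
  tropic_fun a b c (phi (q I1 (sg s)) (q I2 (sg s))) <> 0 ->
  (forall k, Derive (fun x => q k (sg x)) s = Derive sg s * Derive (q k) (sg s)) ->
  (forall k, Derive_n (fun x => q k (sg x)) 2 s =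
     Derive_n sg 2 s * Derive (q k) (sg s)
     + Derive sg s ^ 2 * Derive_n (q k) 2 (sg s)) ->
  Derive_n sg 2 s = (m' - m) * (tropic_velocity a b c phi q (sg s)
    / tropic_fun a b c (phi (q I1 (sg s)) (q I2 (sg s)))) * Derive sg s ^ 2 ->
  normal_form a b c m phi q (sg s) ->
  normal_form a b c m' phi (fun k x => q k (sg x)) s.
Proof.
  intros HF H1 H2 Hs (A1 & A2 & A3).
  unfold normal_form, quad_velocity. cbv zeta beta.
  replace (tropic_velocity a b c phi (fun k x => q k (sg x)) s)
    with (Derive sg s * tropic_velocity a b c phi q (sg s)).
  2:{ unfold tropic_velocity. cbv zeta beta.
      rewrite !(fun f => velocity_reparam f q sg s H1). unfold Rdiv. ring. }
  rewrite !(fun f => velocity_reparam f q sg s H1),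
    !(fun f => acceleration_reparam f q sg s H1 H2).
  rewrite A1, A2, A3, Hs. unfold quad_velocity.
  set (F := tropic_fun a b c _) in *.
  repeat split; field; repeat split; lra || assumption.
Qed.

(** Links the chart expression in the normal form to a function of the instant defined without
    charts, from which the change of parameter is built. *)
Lemma tropic_along_curve U phi (q : idx -> R -> R) (gamma : R -> R3) t :
  local_parametrization (ellipsoid_off_tropics a b c) U phi ->
  locally t (fun s => U (q I1 s, q I2 s) /\ gamma s = phi (q I1 s) (q I2 s) /\
    forall k, ex_derive (q k) s /\ ex_derive (Derive (q k)) s) ->
  is_derive (fun s => tropic_fun a b c (gamma s)) t (tropic_velocity a b c phi q t).
Proof.
  intros Hphi Hloc.
  destruct (locally_singleton _ _ Hloc) as (HU & _ & Hq).
  assert (oU := lp_open _ _ _ Hphi).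
  apply (is_derive_ext_loc (fun s => tropic_fun a b c (phi (q I1 s) (q I2 s)))).
  { generalize Hloc. apply filter_imp. now intros s (_ & -> & _). }
  assert (V := fun f Hf => velocity_is_derive U f q t oU Hf HU (fun k => proj1 (Hq k))).
  assert (VX := V _ (lp_smooth_x _ _ _ Hphi)). assert (VY := V _ (lp_smooth_y _ _ _ Hphi)).
  assert (VZ := V _ (lp_smooth_z _ _ _ Hphi)). cbv beta in VX, VY, VZ.
  unfold tropic_velocity, tropic_fun. cbv zeta.
  set (x := fun s => cx (phi (q I1 s) (q I2 s))) in *.
  set (y := fun s => cy (phi (q I1 s) (q I2 s))) in *.
  set (z := fun s => cz (phi (q I1 s) (q I2 s))) in *.
  apply (is_derive_ext (fun s => x s ^ 2 / a ^ 2 + y s ^ 2 / b ^ 2 - z s ^ 2 / c ^ 2));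
    [reflexivity|].
  change (cx (phi (q I1 t) (q I2 t))) with (x t).
  change (cy (phi (q I1 t) (q I2 t))) with (y t).
  change (cz (phi (q I1 t) (q I2 t))) with (z t).
  rewrite <- (is_derive_unique x t _ VX), <- (is_derive_unique y t _ VY),
    <- (is_derive_unique z t _ VZ).
  auto_derive.
  - repeat split; eexists; eassumption.
  - change (Derive (fun s => x s) t) with (Derive x t).
    change (Derive (fun s => y s) t) with (Derive y t).
    change (Derive (fun s => z s) t) with (Derive z t).
    field. lra.
Qed.

Lemma tropic_velocity_continuous U phi (q : idx -> R -> R) t :
  local_parametrization (ellipsoid_off_tropics a b c) U phi ->
  U (q I1 t, q I2 t) ->
  (forall k, ex_derive (q k) t /\ ex_derive (Derive (q k)) t) ->
  continuous (tropic_velocity a b c phi q) t.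
Proof.
  intros Hphi HU Hq.
  assert (oU := lp_open _ _ _ Hphi).
  assert (C : forall f k, smooth_on U f ->
    continuous (fun s => f (q I1 s) (q I2 s) * velocity f q s / k) t).
  { intros f k Hf.
    apply (continuous_mult (fun s => f (q I1 s) (q I2 s) * velocity f q s) (fun _ => / k));
      [|apply continuous_const].
    apply (continuous_mult (fun s => f (q I1 s) (q I2 s)) (velocity f q));
      apply ex_derive_R_continuous.
    - eexists. apply (velocity_is_derive U); auto. intros k'. exact (proj1 (Hq k')).
    - now apply (velocity_ex_derive U). }
  unfold tropic_velocity. cbv zeta.
  apply (continuous_mult (fun _ => 2)); [apply continuous_const|].
  apply (continuous_minus (V := R_NormedModule)).
  - apply (continuous_plus (V := R_NormedModule)).
    + exact (C _ (a ^ 2) (lp_smooth_x _ _ _ Hphi)).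
    + exact (C _ (b ^ 2) (lp_smooth_y _ _ _ Hphi)).
  - exact (C _ (c ^ 2) (lp_smooth_z _ _ _ Hphi)).
Qed.

(** All that the transfer uses of a metric; as the two metrics then differ only in [m], one lemma
    serves both directions. *)
Definition has_normal_form (G : tensor) (m : R) : Prop :=
  forall U phi, local_parametrization (ellipsoid_off_tropics a b c) U phi ->
  forall q t, U (q I1 t, q I2 t) ->
    geodesic_equation G phi q t <-> normal_form a b c m phi q t.

Lemma unparametrized_geodesic_transfer G m G' m' I gamma :
  has_normal_form G m -> has_normal_form G' m' ->
  unparametrized_geodesic (ellipsoid_off_tropics a b c) G I gamma ->
  unparametrized_geodesic (ellipsoid_off_tropics a b c) G' I gamma.
Proof.
  intros HG HG' (J & tau & HJ & Htau & Hgeo).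
  set (f := fun t => tropic_fun a b c (gamma (tau t))).
  destruct (exists_reparametrization J f (m' - m) HJ) as (J' & sg & HJ' & Hsg & E).
  { intros t Ht. destruct (Hgeo t Ht) as (U & phi & q & Hphi & Hloc).
    assert (Hloc' : locally t (fun s => U (q I1 s, q I2 s) /\
      gamma (tau s) = phi (q I1 s) (q I2 s) /\
      forall k, ex_derive (q k) s /\ ex_derive (Derive (q k)) s)).
    { generalize Hloc. apply filter_imp. tauto. }
    destruct (locally_singleton _ _ Hloc') as (HU & Eg & Hq).
    split; [|split].
    - unfold f. rewrite Eg. now apply (chart_on_surface a b c U phi).
    - eexists. now apply (tropic_along_curve U phi q (fun s => gamma (tau s))).
    (* Continuity of the derivative needs its formula on a neighbourhood, hence the chart data
       around every nearby instant. *)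
    - apply (continuous_ext_loc _ (tropic_velocity a b c phi q));
        [|now apply (tropic_velocity_continuous U)].
      generalize (locally_locally _ _ Hloc'). apply filter_imp. intros s Hs.
      symmetry. apply is_derive_unique.
      now apply (tropic_along_curve U phi q (fun s => gamma (tau s))). }
  exists J', (fun s => tau (sg s)). split; [exact HJ'|].
  split; [now apply (reparametrization_comp J' J)|].
  intros s0 Hs0. destruct (proj1 Hsg s0 Hs0) as (Ht0 & Hsg1 & _).
  destruct (Hgeo _ Ht0) as (U & phi & q & Hphi & Hloc).
  exists U, phi, (fun k s => q k (sg s)). split; [exact Hphi|].
  (* The chart stays the same and only [q] is composed with [sg]. The data is kept on a
     neighbourhood of each nearby instant, as the second derivative of the composite requires. *)
  assert (Hs := ex_derive_R_continuous _ _ Hsg1 _ (locally_locally _ _ Hloc)).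
  unfold filtermap in Hs.
  assert (HJs := locally_locally _ _ (proj1 HJ' _ Hs0)).
  generalize (filter_and _ _ Hs HJs). apply filter_imp. clear Hs HJs.
  intros s [Hls HJs].
  destruct (locally_singleton _ _ Hls) as (HU & Eg & Hq & Hge).
  assert (HJ's := locally_singleton _ _ HJs). cbv beta in HJ's.
  destruct (proj1 Hsg s HJ's) as (_ & D1 & D2 & _).
  assert (Q1 : forall k, Derive (fun x => q k (sg x)) s = Derive sg s * Derive (q k) (sg s)).
  { intros k. apply Derive_comp; [exact (proj1 (Hq k))|exact D1]. }
  assert (Q2 : forall k, is_derive (Derive (fun x => q k (sg x))) s
     (Derive_n sg 2 s * Derive (q k) (sg s)
      + Derive sg s ^ 2 * Derive_n (q k) 2 (sg s))).
  { intros k. apply is_derive_Derive_comp; [|exact (proj2 (Hq k))| |exact D2].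
    - generalize Hls. apply filter_imp. intros x (_ & _ & Hx & _). exact (proj1 (Hx k)).
    - generalize HJs. apply filter_imp. intros x Hx. exact (proj1 (proj2 (proj1 Hsg x Hx))). }
  split; [exact HU|]. split; [exact Eg|]. split.
  - intros k. split; [|eexists; apply Q2].
    apply (ex_derive_comp (q k) sg); [exact (proj1 (Hq k))|exact D1].
  - apply (HG' U phi Hphi (fun k s => q k (sg s)) s HU).
    apply (normal_form_reparam m); auto.
    + now apply (chart_on_surface a b c U phi).
    + intros k. apply is_derive_unique, Q2.
    + rewrite (E s HJ's). unfold f at 2. rewrite Eg.
      do 3 f_equal. apply is_derive_unique.
      apply (tropic_along_curve U phi q (fun s => gamma (tau s))); [exact Hphi|].
      generalize Hls. apply filter_imp. tauto.
    + now apply (HG U phi Hphi q (sg s) HU).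
Qed.

End Reparametrization.

Theorem proposition6p2 (a b c : R) (ha : 0 < a) (hb : 0 < b) (hc : 0 < c)
    (hab : b < a) :
  pseudo_riemannian_on (ellipsoid_off_tropics a b c) minkowski /\
  riemannian_on (ellipsoid_off_tropics a b c) (ds2 a b c) /\
  geodesically_equivalent (ellipsoid_off_tropics a b c) minkowski (ds2 a b c).
Proof.
  split; [|split; [split|]].
  - intros U phi Hphi. split.
    + intros i j. now apply (minkowski_gcoef_smooth a b c U phi).
    + intros u v HU. split; [apply minkowski_gcoef_sym|].
      now apply (minkowski_gdet_neq_0 a b c ha hb hc U phi).
  - intros U phi Hphi. split.
    + intros i j. now apply (ds2_gcoef_smooth a b c ha hb hc U phi).
    + intros u v HU. split; [now apply ds2_gcoef_sym|].
      now apply (ds2_gdet_neq_0 a b c ha hb hc U phi).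
  - intros U phi Hphi u v HU xi. now apply (ds2_positive a b c ha hb hc U phi).
  - assert (HM : has_normal_form a b c minkowski 0).
    { intros U phi Hphi q t HU.
      now apply (minkowski_geodesic_normal_form a b c ha hb hc U phi). }
    assert (HD : has_normal_form a b c (ds2 a b c) 1).
    { intros U phi Hphi q t HU.
      now apply (ds2_geodesic_normal_form a b c ha hb hc U phi). }
    intros I gamma _.
    split; eapply unparametrized_geodesic_transfer; eassumption.
Qed.
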